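(* For every integer $n\geq 5$, the automorphism group of the cone complex $M_{0,n}^{\mathrm{trop}}$ and the automorphism group of the extended cone complex $\overline{M}_{0,n}^{\mathrm{trop}}$ are both isomorphic to the symmetric group $S_n$. The automorphism groups of $M_{0,4}^{\mathrm{trop}}$ and of $\overline{M}_{0,4}^{\mathrm{trop}}$ are both isomorphic to $S_3$.
   Context: Trees are finite. A tree $\Gamma$ is a connected graph without cycles, with vertex set $V(\Gamma)$ and edge set $E(\Gamma)$; $E(v)$ is the set of edges incident to $v$ and $\mathrm{val}(v)=|E(v)|$. An $n$-legged tree is a tree $\Gamma$ with a map $\mathrm{leg}_\Gamma\colon I_n=\{1,\dots,n\}\to V(\Gamma)$; put $L(v)=\mathrm{leg}_\Gamma^{-1}(v)$ and $\ell(v)=|L(v)|$. It is stable if $\mathrm{val}(v)+\ell(v)\geq 3$ for every vertex $v$. An isomorphism of $n$-legged trees is a pair of bijections $g_V$, $g_E$ on vertices and edges compatible with incidence and with $L(g_V(v))=L(v)$ for all $v$. For $S\subset E(\Gamma)$, $\Gamma/S$ is the $n$-legged tree obtained by contracting the edges in $S$ (legs are carried along). For a stable $n$-legged tree $\Gamma$ let $C(\Gamma)=\mathbb{R}_{>0}^{E(\Gamma)}$ and $\overline{C(\Gamma)}=\mathbb{R}_{\geq 0}^{E(\Gamma)}$. The cone complex $M_{0,n}^{\mathrm{trop}}$ is obtained by gluing the closed cones $\overline{C(\Gamma)}$, $\Gamma$ ranging over isomorphism classes of stable $n$-legged trees, where the face $\{x_e=0 \text{ for } e\in S\}$ of $\overline{C(\Gamma)}$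 is identified with $\overline{C(\Gamma/S)}$ (via $E(\Gamma/S)=E(\Gamma)\setminus S$). As a set it is the disjoint union of the cells $C(\Gamma)$. A morphism of cone complexes is a continuous map sending each closed cone $\sigma$ into some closed cone $\sigma'$ such that $\sigma\to\sigma'$ is the restriction of an integral linear map (with respect to the lattices $\mathbb{Z}^{E(\Gamma)}$). An automorphism is a morphism with an inverse that is also a morphism. The extended cone complex $\overline{M}_{0,n}^{\mathrm{trop}}$ is obtained by the same gluing from the extended cones $(\mathbb{R}_{\geq 0}\cup\{\infty\})^{E(\Gamma)}$. A face at infinity of such an extended cone is a subset of the form $\{x: x_e=\infty \text{ for } e\in S,\ x_e<\infty\text{ for } e\notin S\}\cong\mathbb{R}_{\geq 0}^{E(\Gamma)\setminus S}$. A morphism of extended cones $\overline\sigma\to\overline\sigma'$ is a continuous map whose restriction to the finite part $\sigma$ is a morphism of cones (restriction of an integral linear map) from $\sigma$ to a face (possibly at infinity) of $\overline\sigma'$. A morphism of extended cone complexes is a continuous map whose restriction to each extended cone $\overline\sigma$ factors through a morphism of extended cones to some extended cone $\overline\sigma'$ of the target; automorphisms are invertible morphisms whose inverse is a morphism. *)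

(* Defs.v *)
From HB Require Import structures.
From Stdlib Require Import Relation_Operators.
From mathcomp Require Import all_boot all_order all_algebra all_fingroup.
From mathcomp Require Import all_classical all_reals all_analysis.
From mathcomp Require Import generic_quotient zify lra.

Set Implicit Arguments.
Unset Strict Implicit.
Unset Printing Implicit Defensive.
Import Order.TTheory GRing.Theory Num.Theory.
Import numFieldNormedType.Exports.

Local Open Scope classical_set_scope.
Local Open Scope ring_scope.

(* Edges form a separate type, so that multigraphs are allowed; the legs are
   indexed by ['I_n] = {0, ..., n-1} rather than {1, ..., n}. *)
Record lgraph (n : nat) (V E : finType) := LGraph {
  ends : E -> {set V};
  leg : 'I_n -> V }.

Section LeggedGraph.
Context {n : nat} {V E : finType}.
Implicit Types (G : lgraph n V E) (S : {set E}).

Definition edges_at G (v : V) : {set E} := [set e | v \in ends G e]%SET.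
Definition legs_at G (v : V) : {set 'I_n} := [set i | leg G i == v]%SET.

Definition adj_in G S : rel V :=
  [rel u v | [exists e in S, ends G e == [set u; v]%SET]].

(* The sequence (v_1, e_1), ..., (v_k, e_k), with k >= 1 and distinct vertices
   and edges, such that e_i joins v_i to v_(i+1) and e_k joins v_k to v_1. *)
Definition graph_cycle G (c : seq (V * E)) : bool :=
  [&& c != [::], uniq (unzip1 c), uniq (unzip2 c)
    & path.cycle (fun p q => ends G p.2 == [set p.1; q.1]%SET) c].

Definition is_tree G : Prop :=
  [/\ (0 < #|V|)%N,
      forall e, #|ends G e| = 2%N,
      forall u v, connect (adj_in G [set: E]%SET) u v
    & forall c, ~~ graph_cycle G c].

Definition stable G : Prop :=
  forall v, (3 <= #|edges_at G v| + #|legs_at G v|)%N.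

(* The vertices of [contract G S] are the connected components of the graph
   with vertices V and edges S. *)
Definition component G S (v : V) : {set V} := [set w | connect (adj_in G S) v w]%SET.

Definition contract_vertex G S : finType :=
  {B : {set V} | B \in [set component G S v | v in V]%SET}.

Definition contract_proj G S (v : V) : contract_vertex G S :=
  exist _ (component G S v) (imset_f (component G S) (isT : v \in V)).

Definition contract G S : lgraph n (contract_vertex G S) {e : E | e \notin S} :=
  LGraph (fun e => [set contract_proj G S v | v in ends G (val e)]%SET)
         (fun i => contract_proj G S (leg G i)).

End LeggedGraph.

Record lgraph_iso n (V E V' E' : finType) (G : lgraph n V E) (G' : lgraph n V' E') :=
  LGraphIso {
    isoV : V -> V';
    isoE : E -> E';
    isoV_bij : bijective isoV;
    isoE_bij : bijective isoE;
    iso_ends : forall v e, (isoV v \in ends G' (isoE e)) = (v \in ends G e);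
    iso_legs : forall v, legs_at G' (isoV v) = legs_at G v }.

(* Every stable tree is isomorphic to one with vertex set ['I_nv] and edge set
   ['I_ne]; isomorphic copies are identified by [glue_step] below, taken with
   an empty set of contracted edges. *)
Record stree (n : nat) := STree {
  nv : nat;
  ne : nat;
  sgraph :> lgraph n 'I_nv 'I_ne;
  stree_tree : is_tree sgraph;
  stree_stable : stable sgraph }.

HB.instance Definition _ n := gen_eqMixin (stree n).
HB.instance Definition _ n := gen_choiceMixin (stree n).

Definition orthant (T : topologicalType) (P : set T) (k : nat) : set 'rV[T]_k :=
  [set x | forall e, P (x 0 e)].
Arguments orthant {T} P k.

Definition coords (T : topologicalType) (P : set T) (k : nat) (x : orthant P k) :
  'rV[T]_k := \val x.

(* The gluing of the cones P ^ E(G), G a stable n-legged tree, along their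
   faces; it is used with P = [0, oo[ in R and P = [0, oo] in \bar R. *)
Section Gluing.
Context (T : topologicalType) (zero : T) (P : set T) (n : nat).

Definition cone_sum : topologicalType := {G : stree n & orthant P (ne G)}.

(* The point q is the image of p under the identification of the face
   {x_e = 0 for e in S} with the cone of a tree isomorphic to the contraction. *)
Definition glue_step (p q : cone_sum) : Prop :=
  exists (S : {set 'I_(ne (projT1 p))})
         (g : lgraph_iso (contract (projT1 p) S) (projT1 q)),
    (forall e, e \in S -> coords (projT2 p) 0 e = zero) /\
    (forall e, coords (projT2 q) 0 (isoE g e) = coords (projT2 p) 0 (val e)).

Definition glue_rel (p q : cone_sum) : bool :=
  `[< clos_refl_sym_trans _ glue_step p q >].

Lemma glue_rel_refl : reflexive glue_rel.
Proof. by move=> p; apply/asboolP; exact: rst_refl. Qed.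

Lemma glue_rel_sym : symmetric glue_rel.
Proof.
by move=> p q; apply/asboolP/asboolP => h; exact: rst_sym.
Qed.

Lemma glue_rel_trans : transitive glue_rel.
Proof.
by move=> q p r /asboolP pq /asboolP qr; apply/asboolP; exact: rst_trans qr.
Qed.

Definition glue_equiv : equiv_rel cone_sum :=
  EquivRel glue_rel glue_rel_refl glue_rel_sym glue_rel_trans.

Definition complex : topologicalType :=
  quotient_topology {eq_quot glue_equiv}%qT.

Definition cone_point (G : stree n) (x : orthant P (ne G)) : complex :=
  \pi_(complex)%qT (existT _ G x).

End Gluing.
Arguments cone_point {T zero P n} G x.

Section Morphisms.
Context (R : realType).

Definition nonneg : set R := [set t | 0 <= t].
Definition enonneg : set (\bar R) := [set t | 0 <= t]%E.

Definition cone (k : nat) : topologicalType := orthant nonneg k.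
Definition econe (k : nat) : topologicalType := orthant enonneg k.

Definition Mtrop (n : nat) : topologicalType := complex (0 : R) nonneg n.
Definition eMtrop (n : nat) : topologicalType := complex (0%E : \bar R) enonneg n.

Definition cone_morphism (a b : nat) (f : cone a -> cone b) : Prop :=
  exists A : 'M[int]_(a, b),
    forall x, coords (f x) = coords x *m map_mx intr A.

Definition complex_morphism (n m : nat) (f : Mtrop n -> Mtrop m) : Prop :=
  continuous f /\
  forall G : stree n, exists (H : stree m) (g : cone (ne G) -> cone (ne H)),
    cone_morphism g /\ forall x, f (cone_point G x) = cone_point H (g x).

(* For S empty this is the finite part. *)
Definition face_at_infinity (b : nat) (S : {set 'I_b}) : set (econe b) :=
  [set z : econe b | forall j,
    if j \in S then coords z 0 j = +oo%E else (coords z 0%R j < +oo)%E].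

(* The face at infinity of S is identified with the cone of the coordinates not
   in S, hence only the columns of A which are not in S matter. Ordinary faces
   of faces at infinity need no separate mention, being contained in them. *)
Definition econe_morphism (a b : nat) (f : econe a -> econe b) : Prop :=
  continuous f /\
  exists (S : {set 'I_b}) (A : 'M[int]_(a, b)),
    forall (x : econe a) (y : 'rV[R]_a), coords x = map_mx EFin y ->
      face_at_infinity S (f x) /\
      forall j, j \notin S -> coords (f x) 0 j = ((y *m map_mx intr A) 0 j)%:E.

Definition ecomplex_morphism (n m : nat) (f : eMtrop n -> eMtrop m) : Prop :=
  continuous f /\
  forall G : stree n, exists (H : stree m) (g : econe (ne G) -> econe (ne H)),
    econe_morphism g /\ forall x, f (cone_point G x) = cone_point H (g x).

End Morphisms.

Lemma coords_cvgP (T : topologicalType) (P : set T) (k : nat) (I : Type)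
    (F : set_system I) (w : I -> orthant P k) (z : orthant P k) : Filter F ->
  w @ F --> z <-> forall j, coords (w i) 0 j @[i --> F] --> coords z 0 j.
Proof.
move=> FF; split=> [wz j|wz].
- have cj : {for z, continuous (fun z : orthant P k => coords z 0 j)}.
    apply: (@continuous_comp _ _ _ (fun z : orthant P k => coords z)
      (fun M : 'M[T]_(1, k) => M 0 j)); first exact: initial_continuous.
    move=> U Uj; exists (fun i j' => if j' == j then U else setT).
      move=> i j'; case: eqP => [->|_]; last exact: filterT.
      by rewrite (ord1 i).
    by move=> M /(_ 0 j); rewrite eqxx.
  exact: (cvg_comp _ _ wz cj).
- move=> U [_ [[W oW <-] Wz WU]].
  have : nbhs (coords z) W by apply: open_nbhs_nbhs.
  case=> Q Qz QW.
  have H : \forall i \near F, forall j, Q 0 j (coords (w i) 0 j).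
    by apply: filter_forall => j; exact: wz.
  apply: filterS H => i Hi; apply: WU; apply: QW => i' j.
  by rewrite (ord1 i'); exact: Hi.
Qed.

Section MorphismClosure.
Context (R : realType).

Lemma cone_morphism_id a : cone_morphism (@id (cone R a)).
Proof. by exists 1%:M => x; rewrite map_mx1 mulmx1. Qed.

Lemma cone_morphism_comp a b c (f : cone R a -> cone R b) (g : cone R b -> cone R c) :
  cone_morphism f -> cone_morphism g -> cone_morphism (g \o f).
Proof.
move=> [A fA] [B gB]; exists (A *m B) => x /=.
by rewrite gB fA map_mxM mulmxA.
Qed.

Lemma complex_morphism_id n : complex_morphism (@id (Mtrop R n)).
Proof.
split=> [x|G]; first exact: cvg_id.
by exists G, id; split=> //; exact: cone_morphism_id.
Qed.

Lemma complex_morphism_comp n m p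
    (f : Mtrop R n -> Mtrop R m) (g : Mtrop R m -> Mtrop R p) :
  complex_morphism f -> complex_morphism g -> complex_morphism (g \o f).
Proof.
move=> [cf mf] [cg mg]; split=> [x|G]; first exact: continuous_comp (cf x) (cg _).
have [H [f' [f'P fE]]] := mf G; have [K [g' [g'P gE]]] := mg H.
exists K, (g' \o f'); split=> [|x /=]; first exact: cone_morphism_comp f'P g'P.
by rewrite fE gE.
Qed.

Lemma econe_morphism_id a : econe_morphism (@id (econe R a)).
Proof.
split=> [x|]; first exact: cvg_id.
exists finset.set0, 1%:M => x y xy; split=> [j|j _].
  by rewrite inE xy mxE ltry.
by rewrite map_mx1 mulmx1 xy mxE.
Qed.

Lemma econe_morphism_comp a b c (f : econe R a -> econe R b)
    (g : econe R b -> econe R c) :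
  econe_morphism f -> econe_morphism g -> econe_morphism (g \o f).
Proof.
move=> [cf [S [A fA]]] [cg [T [B gB]]].
split=> [x|]; first exact: continuous_comp (cf x) (cg _).
pose A' : 'M[int]_(a, b) := \matrix_(i, j) (if j \in S then 0 else A i j).
pose s : 'rV[int]_b := \row_j (j \in S)%:R.
exists [set k | (k \in T) || ((s *m B) 0 k != 0)]%SET, (A' *m B) => x y xy.
pose v : 'rV[R]_b := y *m map_mx intr A'.
pose w (N : nat) : 'rV[R]_b := N%:R *: map_mx intr s + v.
have fxE j : j \notin S -> coords (f x) 0 j = (v 0 j)%:E.
  move=> jS; have [_ /(_ j jS) ->] := fA x y xy; congr EFin.
  by rewrite !mxE; apply: eq_bigr => i _; rewrite !mxE (negbTE jS).
have fxS j : j \in S -> coords (f x) 0 j = +oo%E.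
  by move=> jS; have [/(_ j)] := fA x y xy; rewrite jS.
have vS j : j \in S -> v 0 j = 0.
  by move=> jS; rewrite mxE big1// => i _; rewrite !mxE jS mulr0.
have wE N j : w N 0 j = if j \in S then N%:R else v 0 j.
  rewrite /w 4!mxE; case: ifPn => jS; last by rewrite mulr0 add0r.
  by rewrite mulr1 vS ?addr0.
have wP N : orthant (@enonneg R) b (map_mx EFin (w N)).
  move=> j; rewrite /enonneg /= mxE lee_fin wE; case: ifPn => // jS.
  rewrite -lee_fin -fxE//.
  by have /set_mem := valP (f x); apply.
pose W N : econe R b := SigSub (mem_set (wP N)).
have Wf : W N @[N --> \oo] --> f x.
  apply/coords_cvgP => j.
  have -> : (fun N => coords (W N) 0 j) = (fun N => (w N 0 j)%:E).
    by apply/funext => N; rewrite /coords/= mxE.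
  under eq_fun do rewrite wE.
  case: (boolP (j \in S)) => jS.
    by rewrite fxS//; apply/cvgeryP; exact: cvgr_idn.
  by rewrite fxE//; exact: cvg_cst.
have gWf : g (W N) @[N --> \oo] --> g (f x).
  exact: (cvg_comp _ _ Wf (cg (f x))).
have gW N := gB (W N) (w N) erefl.
have wB N k : (w N *m map_mx intr B) 0 k =
    N%:R * ((s *m B) 0 k)%:~R + (y *m map_mx intr (A' *m B)) 0 k.
  by rewrite /w mulmxDl -scalemxAl -map_mxM /v -mulmxA -map_mxM 3!mxE.
have key k : if k \in [set k | (k \in T) || ((s *m B) 0 k != 0)]%SET
    then coords (g (f x)) 0 k = +oo%E
    else coords (g (f x)) 0 k = ((y *m map_mx intr (A' *m B)) 0 k)%:E.
  have /coords_cvgP/(_ k) lim := gWf.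
  have limU l : coords (g (W N)) 0 k @[N --> \oo] --> l -> coords (g (f x)) 0 k = l.
    by move=> h; apply: (cvg_unique (@ereal_hausdorff R) lim h).
  have [kT|kT] := boolP (k \in T).
    rewrite inE kT /=; apply: limU.
    have -> : (fun N => coords (g (W N)) 0 k) = cst +oo%E.
      by apply/funext => N; have [/(_ k)] := gW N; rewrite kT.
    exact: cvg_cst.
  rewrite inE (negbTE kT) /=.
  set d := (y *m _) 0 k in wB *; set c' := (s *m B) 0 k.
  have gE N : coords (g (W N)) 0 k = (N%:R * c'%:~R + d)%:E.
    by have [_ /(_ k kT) ->] := gW N; rewrite wB.
  have [s0|s0|s0] := ltgtP c' 0 => /=.
  - suff : False by [].
    have := archi_boundP (normr_ge0 d); set N := Num.bound _ => dN.
    have : (0 <= coords (g (W N)) 0%R k)%E by have /set_mem := valP (g (W N)); apply.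
    rewrite gE lee_fin leNgt => /negP; apply.
    have c1 : c'%:~R <= -1 :> R.
      have : c' <= -1 by move: s0; clear; lia.
      by rewrite -(ler_int R) rmorphN1.
    have Nc : N%:R * c'%:~R <= - N%:R :> R by rewrite -[X in _ <= X]mulrN1 ler_wpM2l.
    by have := ler_norm d; lra.
  - apply: limU; under eq_fun do rewrite gE.
    apply/cvgeryP/cvgryPge => M; near=> N.
    have c1 : 1 <= c'%:~R :> R.
      have : 1 <= c' by move: s0; clear; lia.
      by rewrite -(ler_int R).
    have NM : M - d <= N%:R by near: N; exact: nbhs_infty_ger.
    have : N%:R * 1 <= N%:R * c'%:~R :> R by rewrite ler_wpM2l.
    lra.
  - apply: limU; under eq_fun do rewrite gE.
    by rewrite s0; under eq_fun do rewrite mulr0 add0r; exact: cvg_cst.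
split=> [k|k kn] /=; move: (key k).
  by case: ifP => // _ ->; rewrite ltry.
by rewrite (negbTE kn).
Unshelve. all: by end_near. Qed.

Lemma ecomplex_morphism_id n : ecomplex_morphism (@id (eMtrop R n)).
Proof.
split=> [x|G]; first exact: cvg_id.
by exists G, id; split=> //; exact: econe_morphism_id.
Qed.

Lemma ecomplex_morphism_comp n m p
    (f : eMtrop R n -> eMtrop R m) (g : eMtrop R m -> eMtrop R p) :
  ecomplex_morphism f -> ecomplex_morphism g -> ecomplex_morphism (g \o f).
Proof.
move=> [cf mf] [cg mg]; split=> [x|G]; first exact: continuous_comp (cf x) (cg _).
have [H [f' [f'P fE]]] := mf G; have [K [g' [g'P gE]]] := mg H.
exists K, (g' \o f'); split=> [|x /=]; first exact: econe_morphism_comp f'P g'P.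
by rewrite fE gE.
Qed.

End MorphismClosure.

Record endomonoid (X : Type) := Endomonoid {
  endo :> (X -> X) -> Prop;
  endo_id : endo id;
  endo_comp : forall f g, endo f -> endo g -> endo (g \o f) }.

Record aut (X : Type) (M : endomonoid X) := Aut {
  aut_fun :> X -> X;
  aut_inv : X -> X;
  aut_funP : M aut_fun;
  aut_invP : M aut_inv;
  aut_funK : cancel aut_fun aut_inv;
  aut_invK : cancel aut_inv aut_fun }.

Section AutGroup.
Context (X : Type) (M : endomonoid X).
Implicit Types f g h : aut M.

Lemma aut_eq f g : aut_fun f = aut_fun g -> f = g.
Proof.
case: f g => [f f' Mf Mf' fK f'K] [g g' Mg Mg' gK g'K] /= fg.
case: _ / fg in Mg gK g'K *.
have fg' : f' = g' by apply/funext => x; rewrite -[x in LHS]g'K fK.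
case: _ / fg' in Mg' gK g'K *.
by congr Aut; exact: Prop_irrelevance.
Qed.

Definition aut_one : aut M :=
  Aut (endo_id M) (endo_id M) (fun=> erefl) (fun=> erefl).

(* The product is composition, f being applied last. *)
Definition aut_mul f g : aut M :=
  Aut (endo_comp (aut_funP g) (aut_funP f)) (endo_comp (aut_invP f) (aut_invP g))
      (can_comp (aut_funK f) (aut_funK g)) (can_comp (aut_invK g) (aut_invK f)).

Definition aut_invg f : aut M :=
  Aut (aut_invP f) (aut_funP f) (aut_invK f) (aut_funK f).

Lemma aut_mulA : associative aut_mul.
Proof. by move=> f g h; exact: aut_eq. Qed.

Lemma aut_mul1 : left_id aut_one aut_mul.
Proof. by move=> f; exact: aut_eq. Qed.

Lemma aut_mulr1 : right_id aut_one aut_mul.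
Proof. by move=> f; exact: aut_eq. Qed.

Lemma aut_mulV : left_inverse aut_one aut_invg aut_mul.
Proof. by move=> f; apply: aut_eq; apply/funext => x; exact: aut_funK. Qed.

Lemma aut_mulrV : right_inverse aut_one aut_invg aut_mul.
Proof. by move=> f; apply: aut_eq; apply/funext => x; exact: aut_invK. Qed.

HB.instance Definition _ := gen_eqMixin (aut M).
HB.instance Definition _ := gen_choiceMixin (aut M).
HB.instance Definition _ := isGroup.Build (aut M)
  aut_mulA aut_mul1 aut_mulr1 aut_mulV aut_mulrV.

End AutGroup.

Definition complex_endo (R : realType) (n : nat) : endomonoid (Mtrop R n) :=
  Endomonoid (@complex_morphism_id R n) (@complex_morphism_comp R n n n).

Definition ecomplex_endo (R : realType) (n : nat) : endomonoid (eMtrop R n) :=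
  Endomonoid (@ecomplex_morphism_id R n) (@ecomplex_morphism_comp R n n n).

Definition AutMtrop (R : realType) (n : nat) : groupType := aut (complex_endo R n).
Definition AuteMtrop (R : realType) (n : nat) : groupType := aut (ecomplex_endo R n).

Definition group_isomorphic (G H : groupType) : Prop :=
  exists f : {multiplicative G -> H}, bijective f.

(* Main.v *)
Require Import Defs.
From HB Require Import structures.
From Stdlib Require Import Relation_Operators.
From mathcomp Require Import all_boot all_order all_algebra all_fingroup.
From mathcomp Require Import all_classical all_reals all_analysis.
From mathcomp Require Import generic_quotient zify.

(** An edge of a stable tree cuts the legs into two parts with at least two legs
    each, its split. Distinct edges have distinct splits ([splits_as_inj]), the
    splits of a tree are pairwise compatible ([splits_as_compat]), and a stable
    tree is determined by them: any contraction is isomorphic to the tree built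
    from the laminar family of its splits ([contract_iso]). Therefore a point of
    the complex is the same thing as its weight function on splits, which sends
    the split of an edge to the length of that edge and all other splits to zero
    ([glue_relP], [cweight_inj]). This works for real and for extended real
    lengths alike.

    Let f be an automorphism of the finite complex. Each cone is mapped linearly
    into a cone, and so is each cone by the inverse of f. Since the unit vector
    on a ray is not a sum of points of a cone that are off that ray, and since
    the matrices are integral, unit vectors of rays go to unit vectors of rays
    ([linear_ray]). So f permutes the splits; it preserves compatibility,
    because two splits are compatible exactly when they occur in one tree
    ([ray_image_compat]); and it is determined by this permutation, because it
    is linear on each cone ([conewise_linear_relabel]).

    For n >= 5 a permutation of the splits that preserves compatibility comes
    from a permutation of the legs ([split_bijection_perm]). Indeed a split into
    k and n - k legs is compatible with 2 (2^k + 2^(n-k)) - 4 sets of legs, and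
    for 2 <= k <= n - 2 this number is largest when k is 2 or n - 2; hence pairs
    of legs go to pairs. Two pairs are incompatible exactly when they share one
    leg, so the pairs through a given leg go to pairs any two of which share one
    leg. As there are at least four of them they have a leg in common, and this
    defines the permutation of the legs. Finally a split is determined by the
    pairs that it does not separate. For n = 4 there are three splits, pairwise
    incompatible; the permutations of the legs that fix the last leg permute
    them in all six ways ([split_bijection_perm4]).

    An automorphism f of the extended complex sends finite points to finite
    points ([ecomplex_morphism_linear]): a coordinate that is infinite on the
    image of one finite cone is infinite at the image of the origin, hence on
    the images of all finite cones and, by density, on the image of f, which
    contains the origin. So the argument above applies to the finite points, and
    f is determined by its values there by continuity ([eaut_relabel_eq]). *)

Set Implicit Arguments.
Unset Strict Implicit.
Unset Printing Implicit Defensive.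
Import Order.TTheory GRing.Theory Num.Theory.
Import numFieldNormedType.Exports.

Local Open Scope set_scope.
Local Open Scope nat_scope.

(** * Edges of a tree as separators *)

Lemma connect_mono (T : finType) (e e' : rel T) (Q : pred T) x y :
  (forall u v, Q u -> e u v -> Q v /\ e' u v) -> Q x -> connect e x y ->
  connect e' x y.
Proof.
move=> ee' + /connectP[p + ->{y}].
elim: p x => [x _ _|v p IH x Qx] /=; first exact: connect0.
case/andP=> exv pv; have [Qv e'xv] := ee' _ _ Qx exv.
by apply: connect_trans (connect1 e'xv) _; exact: IH.
Qed.

Lemma connect_closed (T : finType) (e : rel T) (Q : pred T) x y :
  (forall u v, Q u -> e u v -> Q v) -> Q x -> connect e x y -> Q y.
Proof.
move=> eQ + /connectP[p + ->{y}].
by elim: p x => [//|v p IH x] /= Qx /andP[/(eQ _ _ Qx) Qv /IH]; apply.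
Qed.

Lemma connect_invariant (T : finType) (S : Type) (e : rel T) (h : T -> S) x y :
  (forall u v, e u v -> h u = h v) -> connect e x y -> h x = h y.
Proof.
move=> eh /connectP[p + ->{y}].
by elim: p x => [//|v p IH x] /= /andP[/eh-> /IH].
Qed.

Section Separation.
Context {n : nat} {V E : finType} (G : lgraph n V E).
Implicit Types (S : {set E}) (e : E) (u v w x y z : V) (A : {set 'I_n}).

Lemma adj_in_sym S : symmetric (adj_in G S).
Proof. by move=> u v; apply: eq_existsb => e; rewrite finset.setUC. Qed.

Lemma connect_adj_sym S : connect_sym (adj_in G S).
Proof. exact/sym_connect_sym/adj_in_sym. Qed.

Lemma connect_adjS S S' x y :
  S \subset S' -> connect (adj_in G S) x y -> connect (adj_in G S') x y.
Proof.
move=> /fintype.subsetP SS'; apply: (connect_mono (Q := predT)) => // u v _.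
by case/exists_inP=> e /SS' eS' ee; split=> //; apply/exists_inP; exists e.
Qed.

Definition sameside e : rel V := connect (adj_in G [set~ e]).

Lemma sameside_refl e x : sameside e x x. Proof. exact: connect0. Qed.

Lemma sameside_sym e x y : sameside e x y = sameside e y x.
Proof. exact: connect_adj_sym. Qed.

Lemma sameside_trans e : transitive (sameside e).
Proof. exact: connect_trans. Qed.

Lemma sameside_left e x y z : sameside e x y -> sameside e x z = sameside e y z.
Proof.
move=> xy; apply/idP/idP; last exact: sameside_trans.
by apply: sameside_trans; rewrite sameside_sym.
Qed.

(** A split is a set of legs up to complement; comparing pairs of legs avoids
    the choice of one of the two sides. *)
Definition splits_as e A : bool :=
  [forall i, forall j, sameside e (leg G i) (leg G j) == ((i \in A) == (j \in A))].

Lemma splits_asP e A :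
  reflect (forall i j, sameside e (leg G i) (leg G j) = ((i \in A) == (j \in A)))
          (splits_as e A).
Proof.
by apply: (iffP forallP) => H i; [move=> j; have /forallP/(_ j)/eqP := H i
  |apply/forallP => j; apply/eqP].
Qed.

(** Lists a path together with its edges in the format of [graph_cycle]. Appending
    its last vertex with one more edge z closes it up; the clause on [a], which
    prolongs the path backwards, makes the induction on the path work. *)
Lemma path_edges S u p : path (adj_in G S) u p -> uniq (u :: p) ->
  exists c : seq (V * E),
    [/\ forall z : E, unzip1 (rcons c (last u p, z)) = u :: p,
        uniq (unzip2 c),
        forall e, e \in unzip2 c -> e \in S /\ {subset ends G e <= u :: p}
      & forall (a : V * E) (z : E), ends G a.2 = [set a.1; u] ->
          path (fun p q => ends G p.2 == [set p.1; q.1]) a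
               (rcons c (last u p, z))].
Proof.
elim: p u => [|v p IH] u /=.
  by move=> _ _; exists [::]; split=> //= a z ->; rewrite eqxx.
case/andP=> /exists_inP[e eS /eqP ee] pv /andP[up uvp].
have [c [c1 c2 cS cp]] := IH v pv uvp.
exists ((u, e) :: c); split=> [z|/=|e'|a z aE] /=.
- by rewrite c1.
- rewrite c2 andbT; apply/negP => /cS[_ /(_ u)].
  by rewrite ee set21 => /(_ isT); move: up => /[swap] ->.
- rewrite inE => /predU1P[->|/cS[e'S e'p]]; last first.
    by split=> // x /e'p; rewrite !inE => ->; rewrite orbT.
  by split=> // x; rewrite ee !inE => /pred2P[] ->; rewrite eqxx ?orbT.
- by rewrite aE eqxx /=; exact: cp.
Qed.

End Separation.

Section Trees.
Context {n : nat} {V E : finType} (G : lgraph n V E).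
Hypothesis treeG : is_tree G.
Implicit Types (S : {set E}) (e : E) (u v w x y z : V) (A : {set 'I_n}).

Notation sameside := (sameside G).
Notation splits_as := (splits_as G).

(** Otherwise a path that avoids e would close up with e to a cycle. *)
Lemma bridge e u v : ends G e = [set u; v] -> ~~ sameside e u v.
Proof.
move=> euv; apply/negP => /connectP[p0 pp0 lastv].
have := euv; rewrite {}lastv.
case/shortenP: pp0 => p pp up _ ep.
have [c [c1 c2 cS cp]] := path_edges pp up.
have [_ _ _ /(_ (rcons c (last u p, e)))/negP] := treeG; apply.
apply/and4P; split.
- by rewrite -size_eq0 size_rcons.
- by rewrite c1.
- rewrite /unzip2 map_rcons rcons_uniq c2 andbT.
  by apply/negP => /cS[]; rewrite !inE eqxx.
- rewrite -(rot_cycle (size c)) -cats1 rot_size_cat /=.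
  by apply: (cp (last u p, e) e); rewrite /= ep finset.setUC.
Qed.

Lemma ends_pair e : exists u v, ends G e = [set u; v].
Proof.
have [_ /(_ e)/eqP/cards2P[u [v [_ ->]]] _ _] := treeG.
by exists u, v.
Qed.

Lemma sameside_ends e e' u v :
  e' != e -> u \in ends G e' -> v \in ends G e' -> sameside e u v.
Proof.
have [a [b eab]] := ends_pair e' => ne; rewrite eab !inE.
have ab : sameside e a b.
  by apply/connect1/exists_inP; exists e'; rewrite ?inE ?eab.
case/pred2P=> ->; case/pred2P=> -> //; first exact: sameside_refl.
  by rewrite sameside_sym.
exact: sameside_refl.
Qed.

Lemma two_sides e u v w :
  ends G e = [set u; v] -> sameside e u w || sameside e v w.
Proof.
move=> euv; have [_ _ /(_ u w) uw _] := treeG.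
apply: (connect_closed (Q := [pred w | sameside e u w || sameside e v w])) uw.
  move=> x y /= ex /exists_inP[e' _ /eqP e'xy].
  have [ee'|e'e] := eqVneq e' e.
    have : y \in ends G e by rewrite -ee' e'xy set22.
    by rewrite euv !inE => /pred2P[] ->; rewrite sameside_refl ?orbT.
  have xy : sameside e x y by apply: (sameside_ends e'e); rewrite e'xy ?set21 ?set22.
  by case/orP: ex => /sameside_trans/(_ xy) ->; rewrite ?orbT.
by rewrite /= sameside_refl.
Qed.

(** A tree without an edge has exactly two parts: every vertex is joined to one of
    the ends of the edge, and the ends are not joined to each other. *)
Lemma sameside_eqb e x y z :
  sameside e y z = (sameside e x y == sameside e x z).
Proof.
have [u [v euv]] := ends_pair e.
have uv := bridge euv.
have H a : sameside e v a = ~~ sameside e u a.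
  have := two_sides a euv; case: (boolP (sameside e u a)) => //= ua _.
  by apply/negP => va; move: uv; rewrite (sameside_left _ ua) sameside_sym va.
have H' a b : sameside e a b = (sameside e u a == sameside e u b).
  case ua: (sameside e u a); first by rewrite -(sameside_left _ ua).
  by have va := H a; rewrite ua in va; rewrite -(sameside_left _ va) H;
     case: (sameside e u b).
rewrite (H' y z) (H' x y) (H' x z); case: (sameside e u x); case: (sameside e u y);
  by case: (sameside e u z).
Qed.

Lemma far_end e x : exists2 y, y \in ends G e & ~~ sameside e x y.
Proof.
have [u [v euv]] := ends_pair e; have := bridge euv.
rewrite (sameside_eqb _ x) euv => uv.
case: (boolP (sameside e x u)) uv => [_|xu _]; first by exists v; rewrite ?set22.
by exists u; rewrite ?set21.
Qed.

Lemma near_end e x : exists2 y, y \in ends G e & sameside e x y.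
Proof.
have [u [v euv]] := ends_pair e; have := bridge euv.
rewrite (sameside_eqb _ x) euv => uv.
case: (boolP (sameside e x u)) uv => [xu _|_]; first by exists u; rewrite ?set21.
by move=> xv; exists v; rewrite ?set22 //; case: (sameside e x v) xv.
Qed.

(** Of the four intersections of a part of the tree without [e1] and a part of
    the tree without [e2], one is empty: the part of [e1] away from [e2] does
    not meet the part of [e2] away from [e1], since a path in the former never
    uses the edge [e2]. *)
Lemma away_sub e1 e2 y z x : e1 != e2 -> y \in ends G e1 -> z \in ends G e2 ->
  ~~ sameside e1 z x -> sameside e2 y x.
Proof.
move=> ne ye1 ze2 zx; have [w we1 zw] := far_end e1 z.
have e2w := sameside_ends ne ye1 we1.
apply: sameside_trans e2w _.
have wx : sameside e1 w x by rewrite (sameside_eqb _ z) (negbTE zw) (negbTE zx).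
apply: (connect_mono (Q := [pred a | ~~ sameside e1 z a])) zw wx => a b /= za.
case/exists_inP=> e; rewrite !inE => e1e /eqP eab.
have ab : sameside e1 a b by apply/connect1/exists_inP; exists e; rewrite ?inE ?eab.
have zb : ~~ sameside e1 z b.
  by apply: contra za => zb; apply: sameside_trans zb _; rewrite sameside_sym.
split=> //; apply/exists_inP; exists e; last by rewrite eab.
rewrite !inE; apply: contra za => /eqP ee2; subst e.
by apply: (sameside_ends e1e ze2); rewrite eab set21.
Qed.

Lemma connect_setU1 S e x y u v : ends G e = [set u; v] ->
  connect (adj_in G (e |: S)) x y ->
  [|| connect (adj_in G S) x y,
      connect (adj_in G S) x u && connect (adj_in G S) v y
    | connect (adj_in G S) x v && connect (adj_in G S) u y].
Proof.
move=> euv /connectP[p + ->]; elim: p x => [x _|z p IH x] /=.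
  by rewrite connect0.
case/andP=> /exists_inP[e'] + /eqP exz; rewrite !inE.
case/predU1P=> [ee'|e'S] /IH; last first.
  have xz : connect (adj_in G S) x z.
    by apply/connect1/exists_inP; exists e'; rewrite ?exz.
  case/or3P=> [/(connect_trans xz)->//|/andP[/(connect_trans xz)-> ->]|
    /andP[/(connect_trans xz)-> ->]]; by rewrite ?orbT.
rewrite {e'}ee' euv in exz.
have : x \in [set u; v] by rewrite exz set21.
have : z \in [set u; v] by rewrite exz set22.
have : u \in [set x; z] by rewrite -exz set21.
have : v \in [set x; z] by rewrite -exz set22.
have uv : u <> v by move=> uv; have := bridge euv; rewrite uv sameside_refl.
rewrite !inE => /pred2P vxz /pred2P uxz /pred2P zuv /pred2P xuv.
have {vxz uxz zuv xuv} : (x = u /\ z = v) \/ (x = v /\ z = u).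
  by case: xuv zuv vxz uxz => + [] => xE zE; rewrite xE zE => -[] ? [] ?; auto.
case=> -[-> ->]; rewrite !connect0 /=.
- by case/or3P=> [->|/andP[_ ->]|->]; rewrite ?orbT.
- by case/or3P=> [->|->|/andP[_ ->]]; rewrite ?orbT.
Qed.

(** The edges outside S can be dropped one at a time: if the edge e were needed to
    join x and y, then x and y would lie with different ends of e, which e
    separates. *)
Lemma connect_sameside S x y :
  connect (adj_in G S) x y <-> forall e, e \notin S -> sameside e x y.
Proof.
split=> [xy e eS|].
  by apply: connect_adjS xy; apply/fintype.subsetP => e' e'S; rewrite !inE;
     apply: contra eS => /eqP <-.
move: {2}#|~: S| (leqnn #|~: S|) => k; elim: k S => [|k IH] S.
  rewrite leqn0 cards_eq0 => /eqP S0 _.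
  have -> : S = [set: E] by rewrite -[S]finset.setCK S0 finset.setC0.
  by have [_ _ + _] := treeG; apply.
move=> cS sS; case: (finset.set_0Vmem (~: S)) => [S0|[e]].
  by apply: IH => //; rewrite S0 cards0.
rewrite inE => eS.
have : connect (adj_in G (e |: S)) x y.
  apply: IH => [|e']; last by rewrite !inE negb_or => /andP[_ /sS].
  rewrite -ltnS; apply: leq_trans cS; apply: proper_card; apply/properP; split.
    by apply/fintype.subsetP => e'; rewrite !inE negb_or => /andP[].
  by exists e; rewrite !inE ?eqxx.
have [u [v euv]] := ends_pair e; have uv := bridge euv.
have Ssub : S \subset [set~ e].
  by apply/fintype.subsetP => e' e'S; rewrite !inE; apply: contraNneq eS => <-.
have xy := sS e eS.
case/(connect_setU1 euv)/or3P=> [//|/andP[xu vy]|/andP[xv uy]]; exfalso.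
- have {}xu : sameside e x u by exact: connect_adjS xu.
  have {}vy : sameside e v y by exact: connect_adjS vy.
  by move: uv; rewrite -(sameside_left _ xu) (sameside_left _ xy) sameside_sym vy.
- have {}xv : sameside e x v by exact: connect_adjS xv.
  have {}uy : sameside e u y by exact: connect_adjS uy.
  by move: uv; rewrite (sameside_left _ uy) -(sameside_left _ xy) xv.
Qed.

End Trees.

(** * The splits of a stable tree *)

Section HalfEdges.
Context {n : nat} {V E : finType} (G : lgraph n V E).

Definition half_edge_at (v : V) (h : E + 'I_n) : bool :=
  match h with inl e => v \in ends G e | inr i => leg G i == v end.

Lemma card_half_edges v :
  #|[set h | half_edge_at v h]| = #|edges_at G v| + #|legs_at G v|.
Proof.
have -> : [set h | half_edge_at v h] =
    [set inl e | e in edges_at G v] :|: [set inr i | i in legs_at G v].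
  apply/setP => -[e|i]; rewrite !inE /=.
    rewrite (mem_imset (edges_at G v) e (@inl_inj _ _)) inE.
    by case: (_ \in ends _ _) => //=; apply/esym/negP => /imsetP[].
  rewrite (mem_imset (legs_at G v) i (@inr_inj _ _)) inE orbC.
  by case: (leg G i == v) => //=; apply/esym/negP => /imsetP[].
rewrite cardsU !card_imset; [|exact: inr_inj|exact: inl_inj].
set I := (X in _ - #|pred_of_set X|); suff -> : I = finset.set0 by rewrite cards0 subn0.
by apply/setP => h; rewrite !inE; apply/negP => /andP[/imsetP[e _ ->] /imsetP[]].
Qed.

Definition beyond (v : V) (h : E + 'I_n) (i : 'I_n) : bool :=
  match h with inl e => ~~ sameside G e v (leg G i) | inr j => j == i end.

End HalfEdges.

(** Two splits cross when they cut the legs into four nonempty parts; splits of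
    the same tree do not cross, since one of the four parts is empty. *)
Definition compat n (A B : {set 'I_n}) : bool :=
  [exists b, exists c, forall i, ((i \in A) == b) ==> ((i \in B) != c)].

Definition proper_split n (A : {set 'I_n}) : bool := (1 < #|A|) && (1 < #|~: A|).

Definition same_split n (A B : {set 'I_n}) : bool := (A == B) || (A == ~: B).

Lemma compatP n (A B : {set 'I_n}) : reflect
  (exists b c, forall i, (i \in A) = b -> (i \in B) = c -> False) (compat A B).
Proof.
apply: (iffP existsP) => -[b].
  by case/existsP => c /forallP H; exists b, c => i /eqP iA /eqP iB; have := H i;
     rewrite iA iB.
case=> c H; exists b; apply/existsP; exists c; apply/forallP => i.
by apply/implyP => /eqP iA; apply/negP => /eqP; exact: H.
Qed.

Lemma same_splitP n (A B : {set 'I_n}) : reflect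
  (forall i j, ((i \in A) == (j \in A)) = ((i \in B) == (j \in B)))
  (same_split A B).
Proof.
apply: (iffP orP) => [[/eqP->//|/eqP->] i j|AB].
  by rewrite !inE; case: (i \in B); case: (j \in B).
case: (pickP 'I_n) => [i _|no]; last by left; apply/eqP/setP => j; have := no j.
have [iAB|iAB] := boolP ((i \in A) == (i \in B)); [left|right];
  apply/eqP/setP => j; have := AB i j; rewrite ?inE; move: iAB;
  by case: (i \in A); case: (i \in B); case: (j \in A); case: (j \in B).
Qed.

Section StableTrees.
Context {n : nat} {V E : finType} (G : lgraph n V E).
Hypothesis treeG : is_tree G.
Hypothesis stableG : stable G.
Implicit Types (e : E) (u v w x y z : V) (A B : {set 'I_n}) (h : E + 'I_n).

Notation sameside := (sameside G).
Notation splits_as := (splits_as G).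
Notation beyond := (beyond G).

Lemma two_more_half_edges v h0 : exists h1 h2, [/\ h1 != h2, h1 != h0, h2 != h0,
  half_edge_at G v h1 & half_edge_at G v h2].
Proof.
have : 1 < #|[set h | half_edge_at G v h] :\ h0|.
  have := stableG v; rewrite -card_half_edges (cardsD1 h0).
  by case: (_ \in _) => // /ltnW.
case/card_gt1P => h1 [h2 [+ +]]; rewrite !inE => /andP[h10 h1v] /andP[h20 h2v] h12.
by exists h1, h2.
Qed.

Lemma beyond_sub v e h i : v \in ends G e -> half_edge_at G v h -> h != inl e ->
  beyond v h i -> sameside e v (leg G i).
Proof.
case: h => [e'|j] ve /= hv ne; last by move=> /eqP<-; rewrite (eqP hv) sameside_refl.
by apply: (away_sub treeG _ hv ve).
Qed.

(** Leaving v through h and going on through edges one ends, the tree being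
    finite, at a vertex which by stability has a leg. *)
Lemma leg_beyond v h : half_edge_at G v h -> exists i, beyond v h i.
Proof.
case: h => [e _|i _] /=; last by exists i.
move: {2}#|[set x | ~~ sameside e v x]| (leqnn #|[set x | ~~ sameside e v x]|) => k.
elim: k e v => [|k IH] e u.
  rewrite leqn0 cards_eq0 => /eqP e0; have [v _ uv] := far_end treeG e u.
  by have := finset.in_set0 v; rewrite -e0 inE uv.
move=> ck; have [v ve uv] := far_end treeG e u.
have [[e'|i] [_ [_ + _ hv _]]] := two_more_half_edges v (inl e); last first.
  by exists i; rewrite (eqP hv).
move=> ne; have sub x : ~~ sameside e' v x -> ~~ sameside e u x.
  move=> v'x; apply: contra uv => ux; apply: sameside_trans ux _.
  by rewrite sameside_sym; exact: (away_sub treeG ne hv ve).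
have [|i /sub] := IH e' v; last by exists i.
rewrite -ltnS; apply: leq_trans ck; apply: proper_card; apply/fintype.properP; split.
  by apply/fintype.subsetP => x; rewrite !inE; exact: sub.
by exists v; rewrite !inE ?sameside_refl.
Qed.

Lemma leg_sameside e x b : exists i, sameside e x (leg G i) = b.
Proof.
case: b.
  have [y ye xy] := far_end treeG e x.
  have [i /= yi] := leg_beyond (h := inl e) (v := y) ye.
  exists i; have := yi; rewrite (sameside_eqb treeG _ x) (negbTE xy).
  by case: (sameside e x (leg G i)).
have [y ye xy] := near_end treeG e x.
have [i /= yi] := leg_beyond (h := inl e) (v := y) ye.
by exists i; rewrite (sameside_left _ xy) (negbTE yi).
Qed.

(** By stability the far end of e has two more half-edges, and disjoint sets of
    legs lie beyond them. *)
Lemma two_legs_beyond e x : exists i j,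
  [/\ i != j, ~~ sameside e x (leg G i) & ~~ sameside e x (leg G j)].
Proof.
have [v ve xv] := far_end treeG e x.
have [h1 [h2 [h12 h1e h2e h1v h2v]]] := two_more_half_edges v (inl e).
have [i h1i] := leg_beyond h1v; have [j h2j] := leg_beyond h2v.
have far h k : half_edge_at G v h -> h != inl e -> beyond v h k ->
    ~~ sameside e x (leg G k).
  move=> hv he hk; apply: contra xv => /sameside_trans; apply.
  by rewrite sameside_sym; exact: beyond_sub hk.
exists i, j; split; [|exact: far h1i|exact: far h2j].
apply: contraNneq h12 => ij; move: h1i h2j; rewrite {}ij.
case: h1 h1v {h1e} => [e1|i1] h1v; case: h2 h2v {h2e} => [e2|i2] h2v.
- move=> /= h1i h2i; apply: contraT => ne; move: h2i.
  by rewrite (away_sub treeG ne h1v h2v h1i).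
- by move=> /= + /eqP ij; rewrite -ij (eqP h2v) sameside_refl.
- by move=> /= /eqP ij; rewrite -ij (eqP h1v) sameside_refl.
- by move=> /= /eqP-> /eqP->.
Qed.

(** The end of e on the side of e' has two more half-edges, and e' lies beyond at
    most one of them. This is why distinct edges have distinct splits. *)
Lemma leg_between e e' z z' : e != e' -> z \in ends G e -> z' \in ends G e' ->
  exists i, sameside e z' (leg G i) /\ sameside e' z (leg G i).
Proof.
move=> ne ze z'e'; have [u ue z'u] := near_end treeG e z'.
have zu : sameside e' z u by apply: (sameside_ends treeG ne ze ue).
have [y ye' uy] := far_end treeG e' u.
have [h [hv he hy]] : exists h, [/\ half_edge_at G u h, h != inl e &
    match h with inl e2 => sameside e2 u y | inr _ => true end].
  have [h1 [h2 [h12 h1e h2e h1u h2u]]] := two_more_half_edges u (inl e).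
  case: h1 h1u h12 h1e => [e1|i1] h1u h12 h1e; last by exists (inr i1).
  case: h2 h2u h12 h2e => [e2|i2] h2u h12 h2e; last by exists (inr i2).
  have [u1y|u1y] := boolP (sameside e1 u y); first by exists (inl e1).
  by exists (inl e2); split=> //; apply: (away_sub treeG _ h1u h2u u1y).
have [i hi] := leg_beyond hv; exists i.
split; first exact: sameside_trans z'u (beyond_sub ue hv he hi).
apply: sameside_trans zu _.
case: h hv he hy hi => [e2|i2] /= hu _ hy; last by move=> /eqP<-; rewrite (eqP hu) sameside_refl.
have e2e' : e2 != e' by apply: contraNneq uy => <-.
rewrite (sameside_left _ hy) => yi; exact: (away_sub treeG e2e' hu ye' yi).
Qed.

Lemma splits_as_inj e e' A : splits_as e A -> splits_as e' A -> e = e'.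
Proof.
move=> /splits_asP eA /splits_asP e'A; apply/eqP; apply: contraT => ne.
have [z [w zw]] := ends_pair treeG e; have [z' [w' zw']] := ends_pair treeG e'.
have ze : z \in ends G e by rewrite zw set21.
have ze' : z' \in ends G e' by rewrite zw' set21.
have [i [ei e'i]] := leg_between ne ze ze'.
have [j ej] := leg_sameside e z' false.
have e'j := away_sub treeG ne ze ze' (negbT ej).
have := eA i j; rewrite -e'A -(sameside_left _ ei) ej.
by rewrite -(sameside_left _ e'i) e'j.
Qed.

Lemma same_split_splits e A B :
  splits_as e A -> splits_as e B = same_split A B.
Proof.
move=> /splits_asP eA; apply/splits_asP/same_splitP => [eB|AB] i j.
  by rewrite -eA eB.
by rewrite eA AB.
Qed.

Lemma splits_as_proper e A : splits_as e A -> proper_split A.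
Proof.
move=> eA; have /splits_asP eA' := eA.
have H b : exists i j, [/\ i != j, (i \in A) = b & (j \in A) = b].
  have [u [v uv]] := ends_pair treeG e.
  have [i _] := leg_sameside e u true.
  have [k kA] : exists k, (k \in A) = ~~ b.
    have [|ib] := eqVneq (i \in A) (~~ b); first by exists i.
    have [k ik] := leg_sameside e (leg G i) false.
    by exists k; move: ik ib; rewrite eA'; do 2!case: (_ \in A); case: b.
  have [i1 [i2 [i12]]] := two_legs_beyond e (leg G k).
  rewrite !eA' kA => i1b i2b; exists i1, i2; split=> //;
    [move: i1b {i2b}|move: i2b {i1b}]; by case: (_ \in A); case: b {kA}.
have [i [j [ij iA jA]]] := H true; have [i' [j' [ij' iA' jA']]] := H false.
by apply/andP; split; apply/card_gt1P; [exists i, j|exists i', j'];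
  split; rewrite // inE ?iA' ?jA'.
Qed.

Lemma splits_as_compat e e' A B : splits_as e A -> splits_as e' B -> compat A B.
Proof.
have [<-|ne] := eqVneq e e'.
  move=> eA; rewrite (same_split_splits _ eA) => /orP[]/eqP->; apply/compatP.
    by exists true, false => i ->.
  by exists true, true => i; rewrite inE => /negbTE ->.
move=> /splits_asP eA /splits_asP eB.
have [z [w zw]] := ends_pair treeG e; have [z' [w' zw']] := ends_pair treeG e'.
have ze : z \in ends G e by rewrite zw set21.
have ze' : z' \in ends G e' by rewrite zw' set21.
have [i ei] := leg_sameside e z' true; have [j e'j] := leg_sameside e' z true.
apply/compatP; exists (~~ (i \in A)), (~~ (j \in B)) => k kA kB.
have ek : ~~ sameside e z' (leg G k).
  by rewrite (sameside_left _ ei) eA kA; case: (i \in A).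
have := away_sub treeG ne ze ze' ek.
by rewrite (sameside_left _ e'j) eB kB; case: (j \in B).
Qed.

End StableTrees.

(** * The tree of a laminar family of sets of legs *)

(** A family of pairwise compatible splits, each given by its side without the
    leg i0; for such sides compatible means nested or disjoint. *)
Definition laminar n (i0 : 'I_n) (F : {set {set 'I_n}}) : Prop :=
  (forall A, A \in F -> i0 \notin A /\ proper_split A) /\
  (forall A B, A \in F -> B \in F -> [|| A \subset B, B \subset A | [disjoint A & B]]).

Section Hierarchy.
Context {n : nat} (i0 : 'I_n) (F : {set {set 'I_n}}).
Hypothesis lamF : laminar i0 F.
Implicit Types (A B C : {set 'I_n}) (i j : 'I_n) (Q : {set {set 'I_n}}).

Definition nodes : {set {set 'I_n}} := finset.setT |: F.

Lemma top_node : finset.setT \in nodes. Proof. exact: setU11. Qed.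

Lemma memF_node A : A \in F -> A \in nodes. Proof. exact: setU1r. Qed.

(** Members of F with a common element form a chain, so their intersection is
    the least of them. *)
Lemma bigcap_chain Q : Q \subset F ->
  (forall A B, A \in Q -> B \in Q -> ~~ [disjoint A & B]) ->
  (\bigcap_(B in Q) B)%SET \in finset.setT |: Q.
Proof.
move=> /fintype.subsetP QF Qmeet; have [->|[A0 A0Q]] := finset.set_0Vmem Q.
  by rewrite finset.big_set0 setU11.
case: (arg_minnP (fun A : {set 'I_n} => #|A|) A0Q) => A AQ Amin.
suff -> : (\bigcap_(B in Q) B)%SET = A by exact: setU1r.
apply/eqP; rewrite finset.eqEsubset; apply/andP; split.
  exact: (finset.bigcap_inf A).
apply/finset.bigcapsP => B BQ.
have := lamF.2 A B (QF _ AQ) (QF _ BQ); rewrite (negbTE (Qmeet _ _ AQ BQ)) orbF.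
case/orP=> // BA; rewrite (_ : B = A)//; apply/eqP.
by rewrite finset.eqEcard BA Amin.
Qed.

Lemma setT1_node Q A : Q \subset F -> A \in finset.setT |: Q -> A \in nodes.
Proof. by move=> /(finset.setUS [set finset.setT])/fintype.subsetP; apply. Qed.

(** Intersections avoid the choice of a least member, and give the whole set of
    legs, the root of the tree, when there is no member to intersect. *)
Definition parent A : {set 'I_n} := (\bigcap_(B in [set B in F | A \proper B]) B)%SET.
Definition leg_node i : {set 'I_n} := (\bigcap_(B in [set B in F | i \in B]) B)%SET.

Lemma F_nonempty A : A \in F -> exists i, i \in A.
Proof.
by case/lamF.1=> _ /andP[/ltnW + _]; rewrite card_gt0 => /finset.set0Pn.
Qed.

Lemma setT_notin_F : finset.setT \notin F.
Proof. by apply/negP => /lamF.1[]; rewrite inE. Qed.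

Lemma parent_mem A : A \in F ->
  parent A \in finset.setT |: [set B in F | A \proper B].
Proof.
move=> AF; have [i iA] := F_nonempty AF; apply: bigcap_chain.
  by apply/fintype.subsetP => B; rewrite inE => /andP[].
move=> B C; rewrite !inE => /andP[_ /proper_sub/fintype.subsetP AB].
case/andP=> _ /proper_sub/fintype.subsetP AC; apply/negP => /pred0P/(_ i) /=.
by rewrite AB ?AC.
Qed.

Lemma parent_node A : A \in F -> parent A \in nodes.
Proof.
move=> AF; apply: (setT1_node _ (parent_mem AF)).
by apply/fintype.subsetP => B; rewrite inE => /andP[].
Qed.

Lemma proper_parent A : A \in F -> A \proper parent A.
Proof.
move=> AF; have := parent_mem AF; rewrite !inE => /orP[/eqP->|/andP[_ //]].
by rewrite properT; apply: contraNneq setT_notin_F => <-.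
Qed.

Lemma leg_node_node i : leg_node i \in nodes.
Proof.
apply: (@setT1_node [set B in F | i \in B]).
  by apply/fintype.subsetP => B; rewrite inE => /andP[].
apply: bigcap_chain; first by apply/fintype.subsetP => B; rewrite inE => /andP[].
move=> B C; rewrite !inE => /andP[_ iB] /andP[_ iC].
by apply/negP => /pred0P/(_ i) /=; rewrite iB iC.
Qed.

Lemma mem_leg_node i : i \in leg_node i.
Proof. by apply/finset.bigcapP => B; rewrite inE => /andP[]. Qed.

Lemma leg_node_sub i B : B \in F -> (leg_node i \subset B) = (i \in B).
Proof.
move=> BF; apply/idP/idP => [/fintype.subsetP/(_ i)|iB].
  by apply; exact: mem_leg_node.
by apply: (finset.bigcap_inf B) => //; rewrite inE BF.
Qed.

Lemma parent_sub A B : A \in F -> B \in F -> (parent A \subset B) = (A \proper B).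
Proof.
move=> AF BF; apply/idP/idP => [|AB]; first exact/proper_sub_trans/proper_parent.
by apply: (finset.bigcap_inf B) => //; rewrite inE BF.
Qed.

(** The largest member of F strictly below A and containing i is a child of A. *)
Lemma node_cover A i : A \in nodes -> i \in A ->
  leg_node i = A \/ exists B, [/\ B \in F, parent B = A & i \in B].
Proof.
move=> AN iA.
pose P B := [&& B \in F, B \proper A & i \in B].
have [/existsP[B0 B0P]|/existsPn noB] := boolP [exists B, P B]; [right|left].
  case: (arg_maxnP (fun B : {set 'I_n} => #|B|) B0P) => B /and3P[BF BA iB] Bmax.
  exists B; split=> //; apply/eqP; rewrite finset.eqEsubset; apply/andP; split.
    move: AN; rewrite !inE => /predU1P[->|AF]; first exact: finset.subsetT.
    by rewrite parent_sub.
  have := parent_mem BF; rewrite !inE => /orP[/eqP->|/andP[pF Bp]].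
    exact: finset.subsetT.
  have ip : i \in parent B by exact: (fintype.subsetP (proper_sub (proper_parent BF))).
  move: AN; rewrite !inE => /predU1P[AT|AF].
    have pT : parent B \proper A.
      by rewrite AT properT; apply: contraNneq setT_notin_F => <-.
    have := Bmax (parent B); rewrite /P pF ip pT => /(_ isT).
    by rewrite /= leqNgt proper_card ?proper_parent.
  case/or3P: (lamF.2 _ _ AF pF) => [//|pA|/pred0P/(_ i) /=]; last by rewrite iA ip.
  have [->//|ne] := eqVneq A (parent B).
  have := Bmax (parent B); rewrite /P pF ip finset.properEneq eq_sym ne pA.
  by move=> /(_ isT); rewrite /= leqNgt proper_card ?proper_parent.
apply/eqP; rewrite finset.eqEsubset; apply/andP; split.
  move: AN; rewrite !inE => /predU1P[->|AF]; first exact: finset.subsetT.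
  by rewrite leg_node_sub.
have := leg_node_node i; rewrite !inE => /predU1P[->|lF]; first exact: finset.subsetT.
have := noB (leg_node i); rewrite /P lF mem_leg_node andbT /= => lA.
move: AN; rewrite !inE => /predU1P[AT|AF].
  by move: lA; rewrite AT properT negbK => /eqP->; exact: finset.subsetT.
case/or3P: (lamF.2 _ _ AF lF) => [//|lA'|/pred0P/(_ i) /=]; last by rewrite iA mem_leg_node.
by move: lA; rewrite properE lA' /= negbK.
Qed.

End Hierarchy.

Section HierarchyTree.
Context {n : nat} (i0 : 'I_n) (F : {set {set 'I_n}}).
Hypothesis lamF : laminar i0 F.
Implicit Types (A B C : {set 'I_n}) (i j : 'I_n).

Notation nodes := (nodes F).
Notation parent := (parent F).
Notation leg_node := (leg_node F).

Definition vlab (v : 'I_#|nodes|) : {set 'I_n} := enum_val v.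
Definition vtx A : 'I_#|nodes| := enum_rank_in (top_node F) A.
Definition elab (k : 'I_#|F|) : {set 'I_n} := enum_val k.

Lemma vtxK A : A \in nodes -> vlab (vtx A) = A.
Proof. exact: enum_rankK_in. Qed.

Lemma vlabK : cancel vlab vtx.
Proof. exact: enum_valK_in. Qed.

Lemma vlab_node v : vlab v \in nodes. Proof. exact: enum_valP. Qed.

Lemma elab_in k : elab k \in F. Proof. exact: enum_valP. Qed.

Lemma elab_inj : injective elab. Proof. exact: enum_val_inj. Qed.

Lemma elab_onto A : A \in F -> exists k, elab k = A.
Proof. by move=> AF; exists (enum_rank_in AF A); exact: enum_rankK_in. Qed.

(** Vertices and edges are numbered, since this is so in [stree]. *)
Definition hierarchy : lgraph n 'I_#|nodes| 'I_#|F| :=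
  LGraph (fun k => [set vtx (elab k); vtx (parent (elab k))])
         (fun i => vtx (leg_node i)).

Lemma eq_vtx v A : A \in nodes -> (v == vtx A) = (vlab v == A).
Proof. by move=> AN; apply/eqP/eqP => [->|<-]; rewrite ?vtxK ?vlabK. Qed.

Lemma in_hierarchy_ends v k : (v \in ends hierarchy k) =
  (vlab v == elab k) || (vlab v == parent (elab k)).
Proof.
rewrite /= !inE !eq_vtx//; first exact: (parent_node lamF (elab_in k)).
exact: memF_node (elab_in k).
Qed.

(** Going to the parent stays within B until B is reached, because the parent is
    the least larger node. *)
Lemma hierarchy_climb (S : {set 'I_#|F|}) B v : B \in nodes -> vlab v \subset B ->
  (forall k, vlab v \subset elab k -> elab k \proper B -> k \in S) ->
  connect (adj_in hierarchy S) v (vtx B).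
Proof.
move=> BN; move: {2}(#|B| - #|vlab v|) (leqnn (#|B| - #|vlab v|)) => m.
elim: m v => [|m IH] v cm vB vS.
  suff -> : v = vtx B by exact: connect0.
  by apply/eqP; rewrite eq_vtx// finset.eqEcard vB -subn_eq0 -leqn0.
have [vBe|ne] := eqVneq (vlab v) B; first by rewrite -vBe vlabK connect0.
have vpB : vlab v \proper B by rewrite finset.properEneq ne.
have vF : vlab v \in F.
  have := vlab_node v; rewrite !inE => /predU1P[vT|//].
  by move: vpB; rewrite vT properE finset.subsetT andbF.
have [k kv] := elab_onto vF.
have pN := parent_node lamF vF.
have vp := proper_parent lamF vF.
have kS : k \in S by apply: vS; rewrite kv.
apply: (@connect_trans _ _ (vtx (parent (vlab v)))).
  by apply/connect1/exists_inP; exists k; rewrite //= kv vlabK.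
apply: IH; rewrite vtxK //.
- by have := proper_card vp; have := proper_card vpB; lia.
- move: BN; rewrite !inE => /predU1P[->|BF]; first exact: finset.subsetT.
  by rewrite (parent_sub lamF).
- by move=> k' pk'; apply: vS; apply: fintype.subset_trans pk'; exact: proper_sub.
Qed.

Lemma card_hierarchy_ends k : #|ends hierarchy k| = 2.
Proof.
rewrite /= cards2 eq_sym eq_vtx; last exact: memF_node (elab_in k).
rewrite vtxK; last exact: (parent_node lamF) (elab_in k).
rewrite (_ : parent _ != _)//.
by apply: contraTneq (proper_parent lamF (elab_in k)) => ->; rewrite fintype.properxx.
Qed.

(** A vertex of minimal size in a cycle would be the lower end of both of the
    edges of the cycle at it. *)
Lemma hierarchy_acyclic c : ~~ graph_cycle hierarchy c.
Proof.
apply/negP => /and4P[+ _ +].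
case: c => // p0 c0 _; set c := p0 :: c0.
have [p pc pmin] : exists2 p, p \in c &
    forall q, q \in c -> #|vlab p.1| <= #|vlab q.1|.
  have p0c : p0 \in c by rewrite /c inE eqxx.
  case: (arg_minnP (P := mem c) (fun p => #|vlab p.1|) p0c) => p pc pmin.
  by exists p => // q qc; exact: pmin.
have low k w : ends hierarchy k = [set p.1; w] -> #|vlab p.1| <= #|vlab w| ->
    vlab p.1 = elab k.
  move=> ek pw; have := in_hierarchy_ends p.1 k; rewrite ek set21.
  case/esym/orP => /eqP // pk.
  have : vtx (elab k) \in [set p.1; w] by rewrite -ek set21.
  have pp := proper_card (proper_parent lamF (elab_in k)).
  have kN := memF_node (elab_in k).
  rewrite !inE => /pred2P[] kw; move: pp; rewrite -pk.
    by rewrite -kw vtxK // ltnn.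
  by rewrite -(vtxK kN) kw ltnNge pw.
case/rot_to: pc => r s rs.
rewrite -(rot_uniq r) -(rot_cycle r) -map_rot rs; case: s rs => [|q s] rs /=.
  move=> _ /andP[/eqP pE _]; have := card_hierarchy_ends p.2.
  by rewrite /= pE cards2 eqxx.
rewrite rcons_path => /andP[pq _] /and3P[/eqP pE _ /eqP lE].
have lc : last q s \in c by rewrite -(mem_rot r) rs inE mem_last orbT.
have qc : q \in c by rewrite -(mem_rot r) rs !inE eqxx orbT.
have plow := low _ _ pE (pmin _ qc).
have llow : vlab p.1 = elab (last q s).2.
  by apply: low (pmin _ lc); exact: etrans lE (finset.setUC _ _).
move: pq; rewrite (elab_inj (etrans (esym plow) llow)) => /negP; apply.
by rewrite -map_cons map_f ?mem_last.
Qed.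

Lemma hierarchy_tree : is_tree hierarchy.
Proof.
split.
- by rewrite card_ord; apply/card_gt0P; exists finset.setT; exact: top_node.
- exact: card_hierarchy_ends.
- have top v : connect (adj_in hierarchy finset.setT) v (vtx finset.setT).
    by apply: hierarchy_climb => [||k _ _]; rewrite ?top_node ?finset.subsetT ?inE.
  move=> u v; apply: (@connect_trans _ _ (vtx finset.setT)); first exact: top.
  by rewrite connect_adj_sym; exact: top.
- exact: hierarchy_acyclic.
Qed.

Lemma elab_sub_node k v w : ends hierarchy k = [set v; w] -> forall A, A \in F ->
  A != elab k -> (vlab v \subset A) = (vlab w \subset A).
Proof.
move=> ek A AF Ak.
have H : (elab k \subset A) = (parent (elab k) \subset A).
  by rewrite (parent_sub lamF) ?elab_in// finset.properEneq eq_sym Ak.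
have E x : x \in [set v; w] -> (vlab x \subset A) = (elab k \subset A).
  by rewrite -ek in_hierarchy_ends => /orP[/eqP->|/eqP->].
by rewrite !E ?set21 ?set22.
Qed.

(** Leaving the nodes contained in A is possible only through the edge from A to its
    parent; without that edge these nodes climb to A, and the others to the root. *)
Lemma hierarchy_splits k : splits_as hierarchy k (elab k).
Proof.
have inv v w : sameside hierarchy k v w ->
    (vlab v \subset elab k) = (vlab w \subset elab k).
  apply: (connect_invariant (h := fun x => vlab x \subset elab k)) => x y.
  case/exists_inP=> k'; rewrite !inE => kk' /eqP ek'.
  apply: (elab_sub_node ek'); first exact: elab_in.
  by apply: contra kk' => /eqP/elab_inj ->.
have to v : sameside hierarchy k v
    (vtx (if vlab v \subset elab k then elab k else finset.setT)).
  case: ifPn => vk; apply: hierarchy_climb;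
    rewrite ?top_node ?finset.subsetT ?(memF_node (elab_in k)) // => k' vk' k'B.
    by rewrite !inE; apply: contraTneq k'B => ->; rewrite fintype.properxx.
  by rewrite !inE; apply: contraNneq vk => <-.
have side v w : sameside hierarchy k v w =
    ((vlab v \subset elab k) == (vlab w \subset elab k)).
  apply/idP/eqP => [/inv//|vw]; apply: sameside_trans (to v) _.
  by rewrite vw sameside_sym.
apply/splits_asP => i j; rewrite side /= !vtxK ?(leg_node_node lamF)//.
by rewrite !leg_node_sub ?elab_in.
Qed.

Definition block (h : 'I_#|F| + 'I_n) : {set 'I_n} :=
  match h with inl k => elab k | inr j => [set j] end.

(** The children of a node and its legs other than i0 partition the node minus
    i0, none of them being all of it; the third half-edge is the edge to the
    parent, or the leg i0 at the root. *)
Lemma hierarchy_stable : 2 < n -> stable hierarchy.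
Proof.
move=> n3 v; rewrite -card_half_edges.
have := vlab_node v; set A := vlab v => AN; pose A' := A :\ i0.
have A'2 : 1 < #|A'|.
  move: AN; rewrite !inE => /predU1P[AT|AF].
    have := cardsD1 i0 A; rewrite -/A' AT cardsT card_ord inE => nA.
    by rewrite -(ltn_add2l 1) -[X in _ < X]/(true + #|A'|) -nA.
  have [i0A /andP[A2 _]] := lamF.1 A AF.
  by have := cardsD1 i0 A; rewrite -/A' (negbTE i0A) add0n => <-.
have blockP i : i \in A' -> exists h, [/\ half_edge_at hierarchy v h,
    block h \subset A', block h != A' & i \in block h].
  rewrite !inE => /andP[ii0 iA].
  have [iN|[B [BF pB iB]]] := node_cover lamF AN iA.
    exists (inr i); rewrite /= eq_sym eq_vtx ?(leg_node_node lamF)// iN inE.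
    split=> //; first by rewrite finset.sub1set !inE ii0.
    by apply: contraTneq A'2 => <-; rewrite cards1.
  have [k kB] := elab_onto BF; exists (inl k); split.
  - by rewrite /half_edge_at in_hierarchy_ends kB pB eqxx orbT.
  - have [i0B _] := lamF.1 B BF; rewrite /= kB.
    apply/fintype.subsetP => j jB; rewrite !inE -pB.
    rewrite (fintype.subsetP (proper_sub (proper_parent lamF BF))) // andbT.
    by apply: contraNneq i0B => <-.
  - rewrite /= kB; move: AN; rewrite !inE => /predU1P[AT|AF].
      have [_ /andP[_]] := lamF.1 B BF; apply: contraTneq => ->.
      rewrite /A' AT (_ : ~: _ = [set i0]) ?cards1//.
      by apply/setP => j; rewrite !inE andbT negbK.
    have [i0A _] := lamF.1 A AF.
    have := proper_parent lamF BF; rewrite pB; apply: contraTneq => ->.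
    rewrite properE negb_and negbK; apply/orP; right; apply/fintype.subsetP => j jA.
    by rewrite !inE jA andbT; apply: contraNneq i0A => <-.
  - by rewrite /= kB.
have [h0 h0v h0A] : exists2 h, half_edge_at hierarchy v h &
    ~~ ((block h \subset A') && (block h != A')).
  have := AN; rewrite !inE => /predU1P[AT|AF].
    exists (inr i0); rewrite /=; last by rewrite finset.sub1set !inE eqxx.
    rewrite eq_sym eq_vtx ?(leg_node_node lamF)//.
    have i0A : i0 \in A by rewrite AT inE.
    have [->|[B [BF _ i0B]]] := node_cover lamF AN i0A; first exact: eqxx.
    by have [/negP] := lamF.1 B BF.
  have [k kA] := elab_onto AF; exists (inl k).
    by rewrite /half_edge_at in_hierarchy_ends kA eqxx.
  rewrite /= kA negb_and negbK; apply/orP; right; apply/eqP/setP => j.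
  by rewrite !inE; case: eqVneq => // ->; have [/negbTE->] := lamF.1 A AF.
have [i [_ [iA' _ _]]] := card_gt1P A'2.
have [h1 [h1v h1A h1n ih1]] := blockP i iA'.
have [j jA' jh1] : exists2 j, j \in A' & j \notin block h1.
  have /fintype.properP[_ //] : block h1 \proper A' by rewrite finset.properEneq h1n.
have [h2 [h2v h2A h2n jh2]] := blockP j jA'.
apply/card_gt2P; exists h0, h1, h2; rewrite !inE; split; split=> //.
- by apply: contraNneq h0A => ->; rewrite h1A.
- by apply: contraNneq jh1 => ->.
- by apply: contraNneq h0A => <-; rewrite h2A.
Qed.

End HierarchyTree.

(** * Contractions of a stable tree *)

Section Contraction.
Context {n : nat} {V E : finType} (G : lgraph n V E).

Lemma contract_proj_eq (S : {set E}) u v :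
  contract_proj G S u = contract_proj G S v <-> connect (adj_in G S) u v.
Proof.
split=> [/(congr1 val)/= /setP/(_ v)|uv]; first by rewrite !inE connect0.
apply/val_inj/setP => w; rewrite !inE /=; apply/idP/idP.
  by apply: connect_trans; rewrite connect_adj_sym.
exact: connect_trans uv.
Qed.

Lemma contract_proj_surj (S : {set E}) (b : contract_vertex G S) :
  exists v, contract_proj G S v = b.
Proof. by case/imsetP: (valP b) => v _ bE; exists v; apply/val_inj; rewrite bE. Qed.

(** The edges in S stay on one side of e, so that whole components of S do. *)
Lemma contract_sameside (treeG : is_tree G) (S : {set E})
    (e : {e : E | e \notin S}) x y :
  sameside (Defs.contract G S) e (contract_proj G S x) (contract_proj G S y) =
  sameside G (val e) x y.
Proof.
pose p := contract_proj G S.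
have Ssub : S \subset [set~ val e].
  by apply/fintype.subsetP => e' e'S; rewrite !inE; apply: contraNneq (valP e) => <-.
have step a b : p a = p b -> sameside G (val e) a b.
  by move/contract_proj_eq; exact: connect_adjS.
apply/idP/idP; last first.
  case/connectP => q + ->; elim: q x => [|z q IH] x /=; first by rewrite sameside_refl.
  case/andP=> /exists_inP[e']; rewrite !inE => e'e /eqP e'E /IH; apply: sameside_trans.
  have [e'S|e'S] := boolP (e' \in S).
    suff -> : contract_proj G S x = contract_proj G S z by exact: sameside_refl.
    apply/contract_proj_eq/connect1/exists_inP; exists e' => //; exact/eqP.
  apply/connect1/exists_inP; exists (exist _ e' e'S); first by rewrite !inE -val_eqE.
  by rewrite /= e'E imsetU1 imset_set1.
move=> xy; suff : forall b, sameside (Defs.contract G S) e (p x) b ->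
    forall z, p z = b -> sameside G (val e) x z by move=> /(_ _ xy y erefl).
move=> b xb; apply/asboolP; pose Q : pred (contract_vertex G S) :=
  fun b => `[< forall z, p z = b -> sameside G (val e) x z >].
suff : Q b by []; apply: connect_closed xb.
  move=> b1 b2 /asboolP b1x /exists_inP[e']; rewrite !inE -val_eqE => e'e.
  have [a [c e'ac]] := ends_pair treeG (val e').
  rewrite /= e'ac imsetU1 imset_set1 => /eqP pac.
  have ac : sameside G (val e) a c.
    by apply/connect1/exists_inP; exists (val e'); rewrite ?inE ?e'ac.
  have : b1 \in [set p a; p c] by rewrite pac set21.
  have : b2 \in [set p a; p c] by rewrite pac set22.
  rewrite !inE => b2ac b1ac; apply/asboolP => z pz.
  have [d xd dac] : exists2 d, sameside G (val e) x d & d \in [set a; c].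
    by case/pred2P: b1ac => b1E; [exists a|exists c];
      rewrite ?set21 ?set22//; apply: b1x.
  have xa : sameside G (val e) x a.
    by move: dac xd; rewrite !inE => /pred2P[] -> // /sameside_trans; apply;
       rewrite sameside_sym.
  move: b2ac; rewrite -pz => /pred2P[] pza.
    by apply: sameside_trans xa _; exact/step.
  by apply: sameside_trans xa (sameside_trans ac _); exact/step.
by apply/asboolP => z /esym; exact: step.
Qed.

End Contraction.

Section Far.
Context {n : nat} {V E : finType} (G : lgraph n V E) (i0 : 'I_n).
Hypothesis treeG : is_tree G.
Hypothesis stableG : stable G.
Implicit Types (e : E) (u v w x y z : V) (A B : {set 'I_n}).

(** Rooting the tree at the leg i0 singles out one side of every edge. *)
Definition far e x : bool := ~~ sameside G e (leg G i0) x.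
Definition far_legs e : {set 'I_n} := [set j | far e (leg G j)].

Lemma splits_as_far e : splits_as G e (far_legs e).
Proof.
apply/splits_asP => i j; rewrite (sameside_eqb treeG _ (leg G i0)) !inE.
by rewrite /far; do 2!case: sameside.
Qed.

Lemma far_legs_root e : i0 \notin far_legs e.
Proof. by rewrite inE negbK sameside_refl. Qed.

Lemma far_legs_inj : injective far_legs.
Proof.
move=> e e' ee'; apply: (splits_as_inj treeG stableG (splits_as_far e)).
by rewrite ee' splits_as_far.
Qed.

Lemma far_legsE e A : splits_as G e A -> i0 \notin A -> A = far_legs e.
Proof.
move=> eA i0A; have := splits_as_far e.
rewrite (same_split_splits _ eA) => /orP[/eqP//|/eqP AE].
by move: i0A; rewrite AE inE far_legs_root.
Qed.

Lemma far_edge e : exists x y,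
  [/\ ends G e = [set x; y], far e x & ~~ far e y].
Proof.
have [u [v uv]] := ends_pair treeG e; have := bridge treeG uv.
rewrite (sameside_eqb treeG _ (leg G i0)).
case fu: (sameside _ _ _ u); case fv: (sameside _ _ _ v) => // _.
  by exists v, u; rewrite /far fu fv finset.setUC.
by exists u, v; rewrite /far fu fv.
Qed.

Lemma far_ends e e' x y :
  e != e' -> x \in ends G e -> y \in ends G e -> far e' x = far e' y.
Proof.
move=> ne xe ye; congr (~~ _).
rewrite ![sameside _ _ (leg _ _) _]sameside_sym.
by apply: sameside_left; apply: (sameside_ends treeG ne).
Qed.

(** One of the four intersections of sides of e and e' is empty; which one depends on
    the position of i0, and each position gives one of the alternatives. *)
Lemma far_laminar e e' : e != e' ->
  [\/ forall x, far e x -> far e' x, forall x, far e' x -> far e x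
    | forall x, far e x -> far e' x -> False].
Proof.
move=> ne; have [z [w zw]] := ends_pair treeG e; have [z' [w' zw']] := ends_pair treeG e'.
have ze : z \in ends G e by rewrite zw set21.
have ze' : z' \in ends G e' by rewrite zw' set21.
have H x := away_sub treeG ne ze ze' (x := x).
have H' x : ~~ sameside G e' z x -> sameside G e z' x.
  by move=> zx; apply: (away_sub treeG _ ze' ze zx); rewrite eq_sym.
have side e1 y x : far e1 x = (sameside G e1 y (leg G i0) != sameside G e1 y x).
  by rewrite /far (sameside_eqb treeG _ y).
have [r|r] := boolP (sameside G e z' (leg G i0)); last first.
  apply: Or32 => x; rewrite (side e z') (side e' z) (negbTE r) (H _ r) /=.
  by case: (sameside G e z' x) (H' x) => //; case: (sameside G e' z x) => // /(_ isT).
have [r'|r'] := boolP (sameside G e' z (leg G i0)); last first.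
  apply: Or31 => x; rewrite (side e z') (side e' z) (negbTE r') r /=.
  by case: (sameside G e z' x) (H x) => // /(_ isT) ->.
apply: Or33 => x; rewrite (side e z') (side e' z) r r' /=.
by case: (sameside G e z' x) (H x) => // /(_ isT) ->.
Qed.

Lemma far_legs_nonempty e : exists i, i \in far_legs e.
Proof.
have [i /negbT ei] := leg_sameside treeG stableG e (leg G i0) false.
by exists i; rewrite inE.
Qed.

Lemma far_legs_sub e e' x : far_legs e \subset far_legs e' -> far e x -> far e' x.
Proof.
have [->//|ne] := eqVneq e e' => /fintype.subsetP ee'.
case: (far_laminar ne) => [|e'e|no]; first by apply.
  case/eqP: ne; apply: far_legs_inj; apply/setP => i.
  by apply/idP/idP => [/ee'//|]; rewrite !inE; exact: e'e.
have [i ie] := far_legs_nonempty e; have := ee' i ie.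
by move: ie; rewrite !inE => /no/[apply].
Qed.

Lemma far_legs_laminar (S : {set E}) : laminar i0 [set far_legs e | e in S].
Proof.
split=> [_ /imsetP[e _ ->]|_ _ /imsetP[e _ ->] /imsetP[e' _ ->]].
  by rewrite far_legs_root (splits_as_proper treeG stableG (splits_as_far e)).
have [->|ne] := eqVneq e e'; first by rewrite subxx.
case: (far_laminar ne) => [ee'|ee'|ee'].
- by apply/or3P/Or31/fintype.subsetP => i; rewrite !inE; exact: ee'.
- by apply/or3P/Or32/fintype.subsetP => i; rewrite !inE; exact: ee'.
- apply/or3P/Or33/pred0P => i; rewrite /= !inE; apply/negP => /andP[].
  exact: ee'.
Qed.

End Far.

Lemma inj_surj_bij (T U : Type) (f : T -> U) :
  injective f -> (forall y, exists x, f x = y) -> bijective f.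
Proof.
by move=> finj /choice[g fg]; exists g => // x; apply: finj; rewrite fg.
Qed.

Section ContractIso.
Context {n : nat} {V E : finType} (G : lgraph n V E) (i0 : 'I_n) (S : {set E}).
Hypothesis treeG : is_tree G.
Hypothesis stableG : stable G.
Implicit Types (e : E) (u v w : V) (A B C : {set 'I_n}).

Notation far := (far G i0).
Notation far_legs := (far_legs G i0).

Definition splits_outside : {set {set 'I_n}} := [set far_legs e | e in ~: S].

Notation F := splits_outside.

Let lamF : laminar i0 F := far_legs_laminar i0 treeG stableG (~: S).

Lemma far_legs_outside e : e \notin S -> far_legs e \in F.
Proof. by move=> eS; apply: imset_f; rewrite inE. Qed.

(** The least split having v on its far side; it is the image of v in the tree
    of all the splits of edges outside S. *)
Definition vertex_node v : {set 'I_n} :=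
  (\bigcap_(B in [set far_legs e | e in [set e | (e \notin S) && far e v]]) B)%SET.

Lemma vertex_node_mem v : vertex_node v \in
  finset.setT |: [set far_legs e | e in [set e | (e \notin S) && far e v]].
Proof.
apply: (bigcap_chain lamF) => [|_ _ /imsetP[e + ->] /imsetP[e' + ->]].
  by apply: imsetS; apply/fintype.subsetP => e; rewrite !inE => /andP[].
rewrite !inE => /andP[eS ev] /andP[e'S e'v]; apply/negP => /pred0P dis.
have [i ie] := far_legs_nonempty i0 treeG stableG e.
have [i' ie'] := far_legs_nonempty i0 treeG stableG e'.
have [ee'|ne] := eqVneq e e'; first by have := dis i; rewrite /= -ee' ie.
case: (far_laminar i0 treeG ne) => [ee'|e'e|]; last by move=> /(_ v ev e'v).
  have := dis i; rewrite /= ie; move: ie; rewrite !inE => /ee' -> //.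
have := dis i'; rewrite /= ie' andbT; move: ie'; rewrite !inE => /e'e -> //.
Qed.

Lemma vertex_node_node v : vertex_node v \in nodes F.
Proof.
apply: setT1_node (vertex_node_mem v).
by apply: imsetS; apply/fintype.subsetP => e; rewrite !inE => /andP[].
Qed.

Lemma vertex_node_sub v e : e \notin S -> (vertex_node v \subset far_legs e) = far e v.
Proof.
move=> eS; apply/idP/idP => [|ev]; last first.
  by apply: (finset.bigcap_inf (far_legs e)) => //; apply: imset_f; rewrite inE eS.
have := vertex_node_mem v; rewrite !inE => /predU1P[->|/imsetP[e' + ->]].
  by rewrite finset.subTset => /eqP eT; have := far_legs_root G i0 e; rewrite eT inE.
by rewrite inE => /andP[_ e'v] /(far_legs_sub treeG stableG); apply.
Qed.

Lemma node_eq A B : A \in nodes F -> B \in nodes F ->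
  (forall e, e \notin S -> (A \subset far_legs e) = (B \subset far_legs e)) -> A = B.
Proof.
move=> AN BN AB.
have sub (C D : {set 'I_n}) : C \in nodes F ->
    (forall e, e \notin S -> (C \subset far_legs e) = (D \subset far_legs e)) ->
    D \subset C.
  rewrite !inE => /predU1P[->|/imsetP[e]]; first by move=> _; exact: finset.subsetT.
  by rewrite inE => eS -> /(_ e eS) <-; exact: subxx.
apply/eqP; rewrite finset.eqEsubset (sub B A BN) ?(sub A B AN) // => e eS.
by rewrite AB.
Qed.

Lemma vertex_node_eq u v :
  vertex_node u = vertex_node v <-> contract_proj G S u = contract_proj G S v.
Proof.
split=> [uv|/contract_proj_eq/(connect_sameside treeG) uv].
  apply/contract_proj_eq/(connect_sameside treeG) => e eS.
  rewrite (sameside_eqb treeG _ (leg G i0)).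
  have := vertex_node_sub u eS; rewrite uv vertex_node_sub // /far.
  by do 2!case: (sameside _ _ (leg _ _) _).
apply: node_eq; rewrite ?vertex_node_node // => e eS.
rewrite !vertex_node_sub // /far; congr (~~ _).
rewrite ![sameside _ _ (leg _ _) _]sameside_sym.
by apply: sameside_left; exact: uv.
Qed.

Lemma vertex_node_leg i : vertex_node (leg G i) = leg_node F i.
Proof.
apply: node_eq; rewrite ?vertex_node_node ?(leg_node_node lamF) // => e eS.
by rewrite vertex_node_sub // leg_node_sub ?far_legs_outside // inE.
Qed.

(** An edge other than e has both ends of e on the same side, so the far end of e
    is beyond exactly those edges whose split contains the split of e. *)
Lemma vertex_node_far e x y : e \notin S -> ends G e = [set x; y] ->
  far e x -> ~~ far e y ->
  vertex_node x = far_legs e /\ vertex_node y = parent F (far_legs e).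
Proof.
move=> eS exy ex ey; have eF := far_legs_outside eS.
have xE e' : e' \notin S -> far e' x = (far_legs e \subset far_legs e').
  move=> e'S; apply/idP/idP => [e'x|/(far_legs_sub treeG stableG)]; last by apply.
  have [->|ne] := eqVneq e e'; first exact: subxx.
  have xy : far e' x = far e' y.
    by apply: (far_ends i0 treeG ne); rewrite exy ?set21 ?set22.
  case: (far_laminar i0 treeG ne) => [ee'|e'e|no].
  - by apply/fintype.subsetP => i; rewrite !inE; exact: ee'.
  - by move: ey; rewrite e'e // -xy.
  - by have := no x ex e'x.
split; apply: node_eq; rewrite ?vertex_node_node ?(parent_node lamF) //.
- exact: memF_node.
- by move=> e' e'S; rewrite vertex_node_sub // xE.
- move=> e' e'S; rewrite vertex_node_sub // (parent_sub lamF) ?far_legs_outside //.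
  have [<-|ne] := eqVneq e e'; first by rewrite fintype.properxx; exact: negbTE.
  rewrite finset.properEneq -xE // (inj_eq (far_legs_inj treeG stableG)) ne /=.
  by apply: (far_ends i0 treeG ne); rewrite exy ?set21 ?set22.
Qed.

(** Two vertices have the same image exactly when no edge outside S separates
    them, that is, when they are contracted to the same vertex. For S empty this
    shows that a stable tree is determined by its splits. *)
Lemma contract_iso : exists g : lgraph_iso (Defs.contract G S) (hierarchy F),
  forall e : {e : E | e \notin S}, elab (isoE g e) = far_legs (val e).
Proof.
have [r rK] := choice (@contract_proj_surj _ _ _ G S).
have onto (e : {e : E | e \notin S}) : exists k : 'I_#|F|, elab k = far_legs (val e).
  by apply: elab_onto; exact: far_legs_outside (valP e).
have [gE gEP] := choice onto.
pose gV b := vtx F (vertex_node (r b)).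
have gVP v : gV (contract_proj G S v) = vtx F (vertex_node v).
  by congr vtx; apply/vertex_node_eq; rewrite rK.
have vlabV b : vlab (gV b) = vertex_node (r b) by rewrite vtxK ?vertex_node_node.
have gV_inj : injective gV.
  move=> b b' /(congr1 (@vlab _ _)); rewrite !vlabV => /vertex_node_eq.
  by rewrite !rK.
have gV_bij : bijective gV.
  apply: inj_surj_bij => // w.
  suff [v vw] : exists v, vertex_node v = vlab w.
    by exists (contract_proj G S v); rewrite gVP vw vlabK.
  have := vlab_node w; rewrite !inE => /predU1P[->|/imsetP[e + ->]]; last first.
    rewrite inE => eS; have [x [y [exy ex ey]]] := far_edge i0 treeG e.
    by exists x; case: (vertex_node_far eS exy ex ey).
  exists (leg G i0); apply: node_eq; rewrite ?vertex_node_node ?top_node // => e eS.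
  rewrite vertex_node_sub // /far sameside_refl finset.subTset; apply/esym/negP => /eqP eT.
  by have := far_legs_root G i0 e; rewrite eT inE.
have gE_bij : bijective gE.
  apply: inj_surj_bij => [e e' /(congr1 (@elab _ _))|k].
    by rewrite !gEP => /(far_legs_inj treeG stableG)/val_inj.
  have /imsetP[e + ek] := elab_in k; rewrite inE => eS.
  by exists (exist _ e eS); apply: elab_inj; rewrite gEP.
have ends_ok (b : contract_vertex G S) (e : {e : E | e \notin S}) : 
    (gV b \in ends (hierarchy F) (gE e)) = (b \in ends (Defs.contract G S) e).
  have [x [y [exy ex ey]]] := far_edge i0 treeG (val e).
  have [xE yE] := vertex_node_far (valP e) exy ex ey.
  rewrite /= exy imsetU1 imset_set1 gEP -yE -xE !inE -!gVP.
  by rewrite !(inj_eq gV_inj).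
have legs_ok (b : contract_vertex G S) :
    legs_at (hierarchy F) (gV b) = legs_at (Defs.contract G S) b.
  apply/setP => i; rewrite !inE /= -vertex_node_leg -gVP.
  by rewrite (inj_eq gV_inj).
by exists (LGraphIso gV_bij gE_bij ends_ok legs_ok).
Qed.

End ContractIso.

(** * Points of the complex as weights on splits *)

Section IsoSplits.
Context {n : nat} {V E V' E' : finType} (G : lgraph n V E) (G' : lgraph n V' E').
Context (g : lgraph_iso G G').

Lemma iso_leg i : leg G' i = isoV g (leg G i).
Proof.
have := iso_legs g (leg G i) => /setP/(_ i); rewrite !inE eqxx.
by move=> /eqP.
Qed.

Lemma iso_adj e u v : adj_in G' [set~ isoE g e] (isoV g u) (isoV g v) =
  adj_in G [set~ e] u v.
Proof.
have ends_eq f : (ends G' (isoE g f) == [set isoV g u; isoV g v]) =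
    (ends G f == [set u; v]).
  have [h hK Kh] := isoV_bij g.
  apply/eqP/eqP => /setP fE; apply/setP => x.
    by rewrite -(iso_ends g) fE !inE !(can_eq hK).
  by rewrite -[x]Kh iso_ends fE !inE !(can_eq hK).
have [h hK Kh] := isoE_bij g.
apply/exists_inP/exists_inP => -[f]; rewrite !inE => fe fuv.
  by exists (h f); rewrite ?inE -?ends_eq ?Kh // -(can_eq hK) Kh.
by exists (isoE g f); rewrite ?inE ?ends_eq ?(can_eq hK).
Qed.

Lemma iso_sameside e x y :
  sameside G' (isoE g e) (isoV g x) (isoV g y) = sameside G e x y.
Proof.
have [h hK Kh] := isoV_bij g; apply/idP/idP.
  move=> xy; rewrite -[x]hK -[y]hK.
  move: xy => /connectP[p + ->]; elim: p (isoV g x) => [|z p IH] w /=.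
    by rewrite sameside_refl.
  case/andP=> wz /IH; apply: connect_trans; apply: connect1.
  by rewrite -iso_adj !Kh.
case/connectP=> p + ->; elim: p x => [|z p IH] w /=; first by rewrite sameside_refl.
by case/andP=> wz /IH; apply: connect_trans; apply: connect1; rewrite iso_adj.
Qed.

Lemma iso_splits e A : splits_as G' (isoE g e) A = splits_as G e A.
Proof.
by apply: eq_forallb => i; apply: eq_forallb => j; rewrite !iso_leg iso_sameside.
Qed.

End IsoSplits.

Lemma contract_splits n (V E : finType) (G : lgraph n V E) (S : {set E})
    (e : {e : E | e \notin S}) A :
  is_tree G -> splits_as (Defs.contract G S) e A = splits_as G (val e) A.
Proof.
move=> treeG; apply: eq_forallb => i; apply: eq_forallb => j.
by rewrite contract_sameside.
Qed.

Section Weight.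
Context {T : Type} (zero : T) {n : nat}.

(** Turns the coordinates on the edges of a tree into a function on splits, so that
    points of the cones of different trees can be compared. The choice of the edge
    does not matter for a stable tree, whose edges have distinct splits. *)
Definition weight (V E : finType) (G : lgraph n V E) (x : E -> T) (A : {set 'I_n}) : T :=
  if [pick e | splits_as G e A] is Some e then x e else zero.

Lemma weight_edge (V E : finType) (G : lgraph n V E) x A e :
  is_tree G -> stable G -> splits_as G e A -> weight G x A = x e.
Proof.
move=> treeG stableG eA; rewrite /weight; case: pickP => [e' e'A|/(_ e)]; last by rewrite eA.
by congr x; exact: splits_as_inj e'A eA.
Qed.

Lemma weight_none (V E : finType) (G : lgraph n V E) x A :
  (forall e, ~~ splits_as G e A) -> weight G x A = zero.
Proof. by move=> noA; rewrite /weight; case: pickP => // e; rewrite (negbTE (noA e)). Qed.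

Lemma weight_neq (V E : finType) (G : lgraph n V E) x A :
  weight G x A <> zero -> exists2 e, splits_as G e A & weight G x A = x e.
Proof. by rewrite /weight; case: pickP => // e eA _; exists e. Qed.

End Weight.

Definition hierarchy_stree n (i0 : 'I_n) (F : {set {set 'I_n}}) (lamF : laminar i0 F)
  (n3 : 2 < n) : stree n := STree (hierarchy_tree lamF) (hierarchy_stable lamF n3).

Section GluingWeights.
Context (T : topologicalType) (zero : T) (P : set T) (n : nat).

Definition sum_weight (p : cone_sum P n) : {set 'I_n} -> T :=
  weight zero (projT1 p) (coords (projT2 p) ord0).

(** Contracting edges of length zero deletes splits of weight zero and keeps the
    weights of the others. *)
Lemma glue_step_weight p q : glue_step zero p q -> sum_weight p = sum_weight q.
Proof.
case: p q => [G x] [H y] [S [g [/= xS xy]]]; apply/funext => A; rewrite /sum_weight /=.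
have tG := stree_tree G; have sG := @stree_stable n G.
have tH := stree_tree H; have sH := @stree_stable n H.
have [h hK Kh] := isoE_bij g.
have split_g e : splits_as H (isoE g e) A = splits_as G (val e) A.
  by rewrite iso_splits contract_splits.
have [/existsP[e eA]|/existsPn noA] := boolP [exists e, splits_as G e A]; last first.
  rewrite !weight_none // => e; rewrite -[e]Kh split_g; exact: noA.
rewrite (weight_edge _ _ tG sG eA); have [eS|eS] := boolP (e \in S); last first.
  by rewrite -(xy (exist _ e eS)) (weight_edge _ _ tH sH (e := isoE g (exist _ e eS))) ?split_g.
rewrite xS // weight_none // => e'; rewrite -[e']Kh split_g.
apply/negP => /(splits_as_inj tG sG eA) e'e.
by have := valP (h e'); rewrite -e'e eS.
Qed.

Context (i0 : 'I_n) (n3 : 2 < n).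

(** A normal form for the gluing: contracting all edges of length zero leads to a
    point which depends on the weights only. *)
Lemma glue_step_hierarchy (p : cone_sum P n) (F : {set {set 'I_n}}) (lamF : laminar i0 F)
    (z : orthant P #|F|) :
  F = [set A : {set 'I_n} | (i0 \notin A) && (sum_weight p A != zero)] ->
  (forall k, coords z ord0 k = sum_weight p (elab k)) ->
  glue_step zero p (existT _ (hierarchy_stree lamF n3) z).
Proof.
case: p => G x; rewrite /sum_weight /=; set w := weight _ _ _.
have tG := stree_tree G; have sG := @stree_stable n G.
pose S := [set e | coords x ord0 e == zero].
have wfar e : w (far_legs G i0 e) = coords x ord0 e.
  by rewrite /w (weight_edge _ _ tG sG (splits_as_far i0 tG e)).
move=> FE zE.
have SF : splits_outside G i0 S = F.
  rewrite FE; apply/setP => A; rewrite inE; apply/imsetP/andP => [[e]|[i0A /eqP wA]].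
    by rewrite !inE => xe ->; rewrite far_legs_root wfar.
  have [e eA we] := weight_neq wA; exists e; last exact: (far_legsE tG eA i0A).
  by rewrite !inE -we; exact/eqP.
have := contract_iso i0 S tG sG; rewrite SF => -[g gE].
exists S, g; split=> [e|e] /=; first by rewrite inE => /eqP.
by rewrite zE gE wfar.
Qed.

(** Points with the same weights are glued to the same normal form. *)
Lemma glue_relP p q : glue_rel zero p q <-> sum_weight p = sum_weight q.
Proof.
split=> [/asboolP|pq].
  by elim=> {p q} [p q|p|p q _ ->|p q r _ -> _ ->] //; exact: glue_step_weight.
case: p pq => G x pq; pose p : cone_sum P n := existT _ G x.
pose F := [set A : {set 'I_n} | (i0 \notin A) && (sum_weight p A != zero)].
have tG := stree_tree G; have sG := @stree_stable n G.
have Fedge A : A \in F -> exists2 e, splits_as G e A & sum_weight p A = coords x ord0 e.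
  by rewrite inE => /andP[_ /eqP wA]; exact: (weight_neq wA).
have lamF : laminar i0 F.
  suff -> : F = [set far_legs G i0 e | e in [set e | far_legs G i0 e \in F]].
    exact: far_legs_laminar.
  apply/setP => A; apply/idP/imsetP => [AF|[e + ->]]; last by rewrite inE.
  have [e eA _] := Fedge A AF; have AE : A = far_legs G i0 e.
    by move: AF; rewrite inE => /andP[i0A _]; exact: (far_legsE tG eA i0A).
  by exists e; last exact: AE; rewrite finset.in_set -AE.
have zP : orthant P #|F| (\row_k sum_weight p (elab k))%R.
  move=> k; rewrite mxE; have [e _ ->] := Fedge _ (elab_in k).
  by have /set_mem := valP x; apply.
pose z : orthant P #|F| := SigSub (mem_set zP).
have zE k : coords z ord0 k = sum_weight p (elab k) by rewrite [LHS]mxE.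
apply/asboolP; apply: (rst_trans _ _ _ (existT _ (hierarchy_stree lamF n3) z)).
  by apply: rst_step; apply: glue_step_hierarchy.
apply/rst_sym/rst_step/glue_step_hierarchy; first by rewrite /F pq.
by move=> k; rewrite zE pq.
Qed.

Local Notation complex := (complex zero P n).

Definition cweight (c : complex) : {set 'I_n} -> T := sum_weight (repr c).

Lemma pi_complexP (p q : cone_sum P n) :
  \pi_(complex)%qT p = \pi_(complex)%qT q <-> sum_weight p = sum_weight q.
Proof.
rewrite -glue_relP.
exact: (rwP (@eqquotP _ _ {eq_quot (glue_equiv zero P n)}%qT p q)).
Qed.

Lemma cweight_pi (p : cone_sum P n) : cweight (\pi_(complex)%qT p) = sum_weight p.
Proof. by apply/pi_complexP; rewrite reprK. Qed.

Lemma cweight_inj : injective cweight.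
Proof.
move=> c d; rewrite -[c]reprK -[d]reprK !cweight_pi => cd.
exact/pi_complexP.
Qed.

Lemma cweight_point (G : stree n) (x : orthant P (ne G)) :
  cweight (cone_point G x) = weight zero G (coords x ord0).
Proof. exact: cweight_pi. Qed.

End GluingWeights.

(** * Bijections of splits that preserve compatibility *)

Section SplitCombinatorics.
Context {n : nat}.
Implicit Types (A B C : {set 'I_n}) (i j k l m : 'I_n).

Lemma compatE A B :
  compat A B = [|| B \subset A, B \subset ~: A, ~: B \subset A | ~: B \subset ~: A].
Proof.
apply/compatP/idP.
  case=> [[] [[] H]]; apply/or4P.
  - apply/Or42/fintype.subsetP => i iB; rewrite inE; apply/negP => iA; exact: H i iA iB.
  - apply/Or44/fintype.subsetP => i; rewrite !inE => iB; apply/negP => iA.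
    exact: H i iA (negbTE iB).
  - apply/Or41/fintype.subsetP => i iB; apply: contraT => iA; case: (H _ (negbTE iA) iB).
  - apply/Or43/fintype.subsetP => i; rewrite !inE => iB; apply: contraT => iA.
    case: (H _ (negbTE iA) (negbTE iB)).
case/or4P => /fintype.subsetP H.
- by exists false, true => i iA /H; rewrite iA.
- by exists true, true => i iA /H; rewrite inE iA.
- by exists false, false => i iA iB; have := H i; rewrite inE iB iA => /(_ isT).
- by exists true, false => i iA iB; have := H i; rewrite !inE iB iA => /(_ isT).
Qed.

Lemma proper_splitP A b : proper_split A ->
  exists i j, [/\ i != j, (i \in A) = b & (j \in A) = b].
Proof.
case: b => /andP[/card_gt1P[i [j [iA jA ij]]] /card_gt1P[i' [j' [iA' jA' ij']]]].
  by exists i, j.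
by exists i', j'; split=> //; apply: negbTE; rewrite -finset.in_setC.
Qed.

(** A split with k legs on one side is compatible with the subsets of its two
    sides and their complements. *)
Lemma card_compat A : proper_split A ->
  #|[set B | compat A B]| + 4 = 2 * (2 ^ #|A| + 2 ^ #|~: A|).
Proof.
move=> pA; pose X := powerset A :|: powerset (~: A).
have cX : #|X| + 1 = 2 ^ #|A| + 2 ^ #|~: A|.
  rewrite /X cardsU !card_powerset.
  have -> : powerset A :&: powerset (~: A) = [set finset.set0].
    apply/setP => B; rewrite !inE.
    apply/andP/eqP => [[/fintype.subsetP BA /fintype.subsetP BA']|->].
      by apply/setP => i; rewrite inE; apply/negP => iB; have := BA' i iB; rewrite inE BA.
    by rewrite !finset.sub0set.
  by rewrite cards1 subnK // addn_gt0 expn_gt0.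
have -> : [set B | compat A B] = X :|: [set ~: B | B in X].
  apply/setP => B; rewrite !inE compatE -[B in B \in imset _ _]finset.setCK.
  by rewrite (mem_imset _ _ (can_inj (@finset.setCK _))) !inE -!orbA.
have XI : #|X :&: [set ~: B | B in X]| = 2.
  have -> : X :&: [set ~: B | B in X] = [set A; ~: A].
    apply/setP => B; rewrite !inE -[B in B \in imset _ _]finset.setCK.
    rewrite (mem_imset _ _ (can_inj (@finset.setCK _))) !inE.
    apply/andP/orP => [[]|[/eqP->|/eqP->]]; last 2 first.
    - by rewrite !subxx !orbT.
    - by rewrite finset.setCK !subxx !orbT.
    have [i [_ [_ iA _]]] := proper_splitP true pA.
    have [j [_ [_ jA _]]] := proper_splitP false pA.
    case/orP=> /fintype.subsetP BA /orP[] /fintype.subsetP AB.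
    - have := BA j; have := AB j; rewrite !inE jA.
      by case: (j \in B) => [_ /(_ isT)|/(_ isT)].
    - left; apply/eqP/setP => l; have := BA l; have := AB l; rewrite !inE.
      by case: (l \in B); case: (l \in A) => // H1 H2;
      first [have := H1 isT | have := H2 isT].
    - right; apply/eqP/setP => l; have := BA l; have := AB l; rewrite !inE.
      by case: (l \in B); case: (l \in A) => // H1 H2;
      first [have := H1 isT | have := H2 isT].
    - have := BA i; have := AB i; rewrite !inE iA.
      by case: (i \in B) => [_ /(_ isT)|/(_ isT)].
  rewrite cards2; case: eqP => // AA.
  have [i [_ [_ iA _]]] := proper_splitP true pA.
  by move/setP/(_ i): AA; rewrite inE iA.
rewrite cardsU XI (card_imset _ (can_inj (@finset.setCK _))).
have : 2 <= #|X| by rewrite -XI subset_leq_card ?finset.subsetIl.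
lia.
Qed.

Definition pair_split A : bool := (#|A| == 2) || (#|~: A| == 2).

(** With k legs on one side the number of compatible sets grows with
    2^k + 2^(n-k), which for 2 <= k <= n - 2 is largest at the two ends only. *)
Lemma pair_split_card A B : proper_split A -> proper_split B ->
  #|[set C | compat A C]| = #|[set C | compat B C]| -> pair_split A -> pair_split B.
Proof.
move=> pA pB cAB; rewrite /pair_split => A2.
have cA := card_compat pA; have cB := card_compat pB.
have sA := cardsC A; have sB := cardsC B; rewrite card_ord in sA sB.
have := pB; rewrite /proper_split; apply: contraTT; rewrite negb_or => /andP[b2 b2'].
apply/negP => /andP[B1 B1'].
have [x xB] : exists x, #|B| = x.+3 by exists (#|B| - 3); lia.
have [y yB] : exists y, #|~: B| = y.+3 by exists (#|~: B| - 3); lia.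
have eA : 2 ^ #|A| + 2 ^ #|~: A| = 4 + 2 ^ (x + y + 4).
  case/orP: A2 => /eqP A2.
    by rewrite A2 (_ : #|~: A| = x + y + 4) //; lia.
  by rewrite A2 (_ : #|A| = x + y + 4) 1?addnC //; lia.
rewrite xB yB in cB; rewrite eA in cA.
have x1 : 0 < 2 ^ x by rewrite expn_gt0.
have y1 : 0 < 2 ^ y by rewrite expn_gt0.
have : 2 ^ (x + y + 4) = 16 * (2 ^ x * 2 ^ y) by rewrite !expnD mulnC.
have : 2 ^ x.+3 = 8 * 2 ^ x by rewrite -addn3 expnD mulnC.
have : 2 ^ y.+3 = 8 * 2 ^ y by rewrite -addn3 expnD mulnC.
nia.
Qed.

(** A proper split that separates i from j has a further leg on both of its sides,
    so that it crosses the pair. *)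
Lemma compat_pair i j A : proper_split A ->
  compat [set i; j] A = ((i \in A) == (j \in A)).
Proof.
move=> pA; apply/compatP/eqP => [[b [c H]]|ij]; last first.
  by exists true, (~~ (i \in A)) => k; rewrite !inE => /pred2P[] ->; rewrite ?ij;
    case: (_ \in A).
have [k [l [kl kA lA]]] := proper_splitP c pA.
case: b H => H; last first.
  have kE : k \in [set i; j] by apply: contraT => /negbTE/H/(_ kA).
  have lE : l \in [set i; j] by apply: contraT => /negbTE/H/(_ lA).
  by move: kE lE kl kA lA; rewrite !inE => /pred2P[] -> /pred2P[] ->;
    rewrite ?eqxx // => _ -> ->.
have iA : i \in A <> c by move/(H i); rewrite !inE eqxx => /(_ isT).
have jA : j \in A <> c by move/(H j); rewrite !inE eqxx orbT => /(_ isT).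
by move: iA jA; case: (i \in A); case: (j \in A); case: c {H kA lA}.
Qed.

Lemma same_split_refl A : same_split A A.
Proof. by rewrite /same_split eqxx. Qed.

Lemma same_splitC A : same_split (~: A) A.
Proof. by rewrite /same_split eqxx orbT. Qed.

Lemma compatC A B : compat A (~: B) = compat A B.
Proof.
apply/compatP/compatP => -[b [c H]]; exists b, (~~ c) => i iA iB.
  by apply: (H i iA); rewrite inE iB negbK.
by apply: (H i iA); move: iB; rewrite inE; case: (i \in B); case: c {H}.
Qed.

Lemma compat_sym A B : compat A B = compat B A.
Proof.
by apply/compatP/compatP => -[b [c H]]; exists c, b => i iB iA; exact: H i iA iB.
Qed.

Lemma compat_same A A' B : same_split A A' -> compat A B = compat A' B.
Proof. by case/orP=> /eqP-> //; rewrite compat_sym compatC compat_sym. Qed.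

End SplitCombinatorics.

Lemma mem_perm_imset n (s : 'S_n) (A : {set 'I_n}) i : (i \in s @: A) = (s^-1%g i \in A).
Proof. by rewrite -{1}[i](permKV s) (mem_imset _ _ (@perm_inj _ s)). Qed.

Lemma same_split_perm n (s : 'S_n) (A B : {set 'I_n}) :
  same_split (s @: A) B = same_split A (s^-1%g @: B).
Proof.
apply/same_splitP/same_splitP => AB i j.
  by rewrite !(mem_perm_imset s^-1) invgK -AB !mem_perm_imset !permK.
by have := AB (s^-1%g i) (s^-1%g j); rewrite !mem_perm_imset !invgK !permKV.
Qed.

Lemma same_split_sym n (A B : {set 'I_n}) : same_split A B = same_split B A.
Proof. by apply/same_splitP/same_splitP => AB i j; rewrite AB. Qed.

Lemma same_split_trans n (A B C : {set 'I_n}) :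
  same_split A B -> same_split B C -> same_split A C.
Proof.
by move=> /same_splitP AB /same_splitP BC; apply/same_splitP => i j; rewrite AB.
Qed.

Lemma compat_improper n (A B : {set 'I_n}) : ~~ proper_split A -> compat A B.
Proof.
have H (C : {set 'I_n}) : (#|C| <= 1)%N -> compat C B.
  move=> C1; have [->|[i iC]] := finset.set_0Vmem C.
    by apply/compatP; exists true, true => i; rewrite inE.
  apply/compatP; exists true, (i \notin B) => j jC.
  have -> : j = i by exact: (card_le1_eqP C1).
  by case: (i \in B).
rewrite negb_and -!leqNgt => /orP[/H//|/H].
by move=> cAB; rewrite compat_sym -compatC compat_sym.
Qed.

Lemma fresh n (s : seq 'I_n) : size s < n -> exists i, i \notin s.
Proof.
move=> sn; case: (pickP (fun i => i \notin s)) => [i is_|all_in]; first by exists i.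
have : size (enum 'I_n) <= size s.
  by apply: uniq_leq_size (enum_uniq _) _ => i _; have := all_in i; case: (i \in s).
by rewrite size_enum_ord leqNgt sn.
Qed.

Lemma card_pairI n (i j : 'I_n) (B : {set 'I_n}) : i != j ->
  #|[set i; j] :&: B| = (i \in B) + (j \in B).
Proof.
move=> ij; have ji : j != i by rewrite eq_sym.
rewrite (cardsD1 i) (cardsD1 j) !inE !eqxx ji orbT /= addnA.
set Z := (X in _ + #|pred_of_set X|); suff -> : Z = finset.set0 by rewrite cards0 addn0.
by apply/setP => k; rewrite !inE; case: (k == i); case: (k == j).
Qed.

Lemma pair_other n (x : 'I_n) (A : {set 'I_n}) : #|A| = 2 -> x \in A ->
  exists2 a, x != a & A = [set x; a].
Proof.
move=> /eqP/cards2P[a [b [ab ->]]]; rewrite !inE; case/pred2P=> ->; first by exists b.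
by exists a; rewrite 1?eq_sym // finset.setUC.
Qed.

Section SplitBijections.
Context {n : nat} (F : {set 'I_n} -> {set 'I_n}).
Hypothesis n5 : 4 < n.
Hypothesis F_inj : injective F.
Hypothesis F_compat : forall A B, compat (F A) (F B) = compat A B.
Hypothesis F_proper : forall A, proper_split (F A) = proper_split A.
Implicit Types (A B : {set 'I_n}) (i j k l m : 'I_n).

(** The side with two legs of the image of a pair; there is one since F preserves
    the number of compatible sets. *)
Definition image_pair i j : {set 'I_n} :=
  let A := F [set i; j] in if #|A| == 2 then A else ~: A.

Local Notation p := image_pair.

Lemma proper_pair i j : i != j -> proper_split [set i; j].
Proof.
move=> ij; have := cardsC [set i; j]; rewrite /proper_split cards2 ij card_ord /=.
by rewrite -[1 < #|_|](ltn_add2l 2) => ->; exact: ltnW.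
Qed.

Lemma image_pairC i j : p i j = p j i.
Proof. by rewrite /p finset.setUC. Qed.

Lemma image_pair_same i j : same_split (p i j) (F [set i; j]).
Proof. by rewrite /p; case: ifP => _; [exact: same_split_refl|exact: same_splitC]. Qed.

Lemma card_image_pair i j : i != j -> #|p i j| = 2.
Proof.
move=> ij; have pF : proper_split (F [set i; j]) by rewrite F_proper proper_pair.
have : pair_split (F [set i; j]).
  apply: (pair_split_card (proper_pair ij) pF); last by rewrite /pair_split cards2 ij.
  rewrite -[RHS](card_preimset _ F_inj); apply: eq_card => C.
  by rewrite !inE F_compat.
by rewrite /pair_split /p; case: ifPn => [/eqP//|_ /= /eqP].
Qed.

Lemma card2_compat A B : #|A| = 2 -> proper_split B ->
  compat A B = ~~ (#|A :&: B| == 1).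
Proof.
move=> /eqP/cards2P[i [j [ij ->]]] pB; rewrite compat_pair // card_pairI //.
by case: (i \in B); case: (j \in B).
Qed.

Lemma image_pairI i j k l : i != j -> k != l ->
  (#|p i j :&: p k l| == 1) = (#|[set i; j] :&: [set k; l]| == 1).
Proof.
move=> ij kl; apply: negb_inj.
have pkl : proper_split (p k l).
  have := cardsC (p k l); rewrite /proper_split card_image_pair // card_ord.
  by rewrite -[1 < #|~: _|](ltn_add2l 2) => ->; exact: ltnW.
rewrite -!card2_compat ?card_image_pair ?proper_pair ?cards2 ?ij ?kl //.
rewrite (compat_same _ (image_pair_same i j)) compat_sym.
by rewrite (compat_same _ (image_pair_same k l)) compat_sym F_compat.
Qed.

(** Four pairs through i go to four pairs any two of which share one leg; three
    of these cannot form a triangle, since the fourth would meet the sides of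
    the triangle in an even number of points altogether. *)
Lemma image_star i : exists x, forall l, l != i -> x \in p i l.
Proof.
have n1 : 1 < n by lia.
have n2 : 2 < n by lia.
have [j] := fresh (s := [:: i]) n1; rewrite !inE => ji.
have [k] := fresh (s := [:: i; j]) n2; rewrite !inE !negb_or => /andP[ki kj].
have ij : i != j by rewrite eq_sym.
have ik : i != k by rewrite eq_sym.
have star u v : u != i -> v != i -> u != v -> #|p i u :&: p i v| == 1.
  move=> ui vi uv; rewrite image_pairI 1?eq_sym // card_pairI 1?eq_sym // !inE eqxx.
  by rewrite (negbTE ui) (negbTE uv).
have jk : j != k by rewrite eq_sym.
have /cards1P[x xE] := star j k ji ki jk.
have xj : x \in p i j by have := set11 x; rewrite -xE inE => /andP[].
have xk : x \in p i k by have := set11 x; rewrite -xE inE => /andP[].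
have [a xa pj] := pair_other (card_image_pair ij) xj.
have [b xb pk] := pair_other (card_image_pair ik) xk.
have ab : a != b.
  apply: contraTneq (star j k ji ki jk) => ab.
  by rewrite pj pk ab finset.setIid cards2 xb.
exists x => l li; have [->//|lj] := eqVneq l j; have [->//|lk] := eqVneq l k.
apply: contraT => xl.
have [m] := fresh (s := [:: i; j; k; l]) n5; rewrite !inE !negb_or.
case/and4P=> mi mj mk ml.
have il : i != l by rewrite eq_sym.
have al : a \in p i l.
  have := star j l ji li; rewrite eq_sym lj => /(_ isT).
  by rewrite pj card_pairI // (negbTE xl); case: (a \in _).
have bl : b \in p i l.
  have := star k l ki li; rewrite eq_sym lk => /(_ isT).
  by rewrite pk card_pairI // (negbTE xl); case: (b \in _).
have pl : p i l = [set a; b].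
  apply/esym/eqP; rewrite finset.eqEcard card_image_pair // cards2 ab andbT.
  by apply/fintype.subsetP => y; rewrite !inE => /pred2P[] ->.
have := star j m ji mi; have := star k m ki mi; have := star l m li mi.
rewrite ![_ == m]eq_sym mj mk ml => /(_ isT) + /(_ isT) + /(_ isT).
rewrite pj pk pl !card_pairI //.
by case: (a \in _); case: (b \in _); case: (x \in _).
Qed.

(** The common leg of the images of the pairs through i defines the permutation.
    Any other split is determined by the pairs compatible with it, which are
    those that it does not separate. *)
Theorem split_bijection_perm :
  exists s : 'S_n, forall A, proper_split A -> same_split (F A) (s @: A).
Proof.
have [s sP] := choice image_star.
have s_inj : injective s.
  move=> i i' ii'; apply/eqP; apply: contraT => ne.
  have n2 : 2 < n by lia.
  have n3 : 3 < n by lia.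
  have [j] := fresh (s := [:: i; i']) n2; rewrite !inE !negb_or => /andP[ji ji'].
  have [k] := fresh (s := [:: i; i'; j]) n3; rewrite !inE !negb_or => /and3P[ki ki' kj].
  have [l] := fresh (s := [:: i; i'; j; k]) n5; rewrite !inE !negb_or.
  case/and4P=> li li' lj lk.
  have same u : u != i -> u != i' -> u != j -> p i j = p i' u.
    move=> ui ui' uj; have ij : i != j by rewrite eq_sym.
    have i'u : i' != u by rewrite eq_sym.
    have := image_pairI ij i'u; rewrite card_pairI // !inE (negbTE ne) [i == u]eq_sym (negbTE ui).
    rewrite (negbTE ji') [j == u]eq_sym (negbTE uj) /=.
    have [a xa ->] := pair_other (card_image_pair ij) (sP i j ji).
    have xi'u : s i \in p i' u by rewrite ii'; exact: sP.
    have [b xb ->] := pair_other (card_image_pair i'u) xi'u.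
    rewrite card_pairI // !inE eqxx [a == s i]eq_sym (negbTE xa) /=.
    by case: (a =P b) => // ->.
  have i'k : i' != k by rewrite eq_sym.
  have i'l : i' != l by rewrite eq_sym.
  have := image_pairI i'k i'l; rewrite -(same k) // -(same l) // finset.setIid.
  rewrite card_image_pair 1?eq_sym // card_pairI // !inE eqxx [k == i']eq_sym.
  by rewrite (negbTE i'k) [k == l]eq_sym (negbTE lk).
pose sigma : 'S_n := perm s_inj.
exists sigma => A pA; apply/same_splitP => i j.
have sA k : (sigma k \in sigma @: A) = (k \in A) by rewrite (mem_imset _ _ perm_inj).
have H k l : ((k \in A) == (l \in A)) = ((sigma k \in F A) == (sigma l \in F A)).
  have [->|kl] := eqVneq k l; first by rewrite !eqxx.
  have pkl : p k l = [set sigma k; sigma l].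
    apply/esym/eqP; rewrite finset.eqEcard card_image_pair // cards2 (inj_eq perm_inj) kl.
    rewrite andbT; apply/fintype.subsetP => y; rewrite !inE !permE => /pred2P[] ->.
      by apply: sP; rewrite eq_sym.
    by rewrite image_pairC; exact: sP.
  rewrite -(compat_pair _ _ pA) -F_compat -(compat_same _ (image_pair_same k l)) pkl.
  by rewrite compat_pair ?F_proper.
have [[i' <-] [j' <-]] : (exists i', sigma i' = i) /\ (exists j', sigma j' = j).
  by split; [exists (sigma^-1%g i)|exists (sigma^-1%g j)]; rewrite permKV.
by rewrite !sA H.
Qed.

End SplitBijections.

Lemma proper_splitC n (A : {set 'I_n}) : proper_split (~: A) = proper_split A.
Proof. by rewrite /proper_split finset.setCK andbC. Qed.

(** Every proper split of four legs has two legs on each side, so it is determined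
    by the partner of the last leg, and any permutation of the three partners
    extends to a permutation of the legs. *)
Lemma split_bijection_perm4 (F : {set 'I_4} -> {set 'I_4}) :
  injective F -> (forall A, proper_split (F A) = proper_split A) ->
  (forall A, (ord_max \in F A) = (ord_max \in A)) ->
  (forall A, F (~: A) = ~: F A) ->
  exists t : 'S_3, forall A, proper_split A ->
    same_split (F A) (lift_perm ord_max ord_max t @: A).
Proof.
move=> F_inj F_proper F_root F_C.
pose P (k : 'I_3) : {set 'I_4} := [set ord_max; lift ord_max k].
have P_inj : injective P.
  move=> k l /setP/(_ (lift ord_max k)); rewrite !inE eqxx orbT.
  by rewrite eq_sym (negbTE (neq_lift _ _)) /= => /esym/eqP/lift_inj.
have pP k : proper_split (P k).
  have := cardsC (P k); rewrite /proper_split /P cards2 neq_lift card_ord.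
  by rewrite -[1 < #|~: _|](ltn_add2l 2) => ->.
have PP A : proper_split A -> ord_max \in A -> exists k, A = P k.
  move=> /andP[A2 A2'] mA.
  have cA : #|A| = 2 by have := cardsC A; rewrite card_ord; lia.
  have [x mx ->] := pair_other cA mA.
  by have [k ->] := unlift_some mx; exists k.
have /choice[t tP] k : exists l, F (P k) = P l.
  by apply: PP; rewrite ?F_proper ?F_root ?pP // /P set21.
have t_inj : injective t.
  by move=> k l kl; apply/P_inj/F_inj; rewrite !tP kl.
exists (perm t_inj) => A pA; set s := lift_perm _ _ _.
have sP k : s @: P k = F (P k).
  by rewrite /P imsetU1 imset_set1 /s lift_perm_id lift_perm_lift permE tP.
have [mA|mA] := boolP (ord_max \in A).
  by have [k ->] := PP A pA mA; rewrite sP same_split_refl.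
have [||k kA] := PP (~: A); rewrite ?inE // ?proper_splitC //.
rewrite -[A]finset.setCK kA F_C -sP.
suff -> : s @: (~: P k) = ~: (s @: P k) by exact: same_split_refl.
apply/setP => i; rewrite -[i](permKV s) inE !(mem_imset _ _ (@perm_inj _ s)).
by rewrite inE.
Qed.

(** * Relabelling the legs *)

Section Relabel.
Context {n : nat}.

(** Precomposition makes the relabellings an action for the product of
    permutations, in which the left factor is applied first. *)
Definition relabel_graph (s : 'S_n) (V E : finType) (G : lgraph n V E) : lgraph n V E :=
  LGraph (ends G) (fun i => leg G (s i)).

Lemma relabel_stable s (V E : finType) (G : lgraph n V E) :
  stable G -> stable (relabel_graph s G).
Proof.
move=> sG v; rewrite (_ : legs_at _ v = s @^-1: legs_at G v); last first.
  by apply/setP => i; rewrite !inE.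
by rewrite card_preimset; [exact: sG|exact: perm_inj].
Qed.

Lemma relabel_splits s (V E : finType) (G : lgraph n V E) e A :
  splits_as (relabel_graph s G) e A = splits_as G e (s @: A).
Proof.
apply/splits_asP/splits_asP => H i j.
  rewrite -[i](permKV s) -[j](permKV s) !(mem_imset _ _ (@perm_inj _ s)).
  exact: H.
have := H (s i) (s j); rewrite !(mem_imset _ _ (@perm_inj _ s)).
exact.
Qed.

Definition relabel (s : 'S_n) (G : stree n) : stree n :=
  @STree n (nv G) (ne G) (relabel_graph s G) (stree_tree G)
    (relabel_stable s (@stree_stable n G)).

Lemma relabel_weight (T : Type) (zero : T) s (G : stree n) (x : 'I_(ne G) -> T) A :
  weight zero (relabel s G) x A = weight zero G x (s @: A).
Proof.
rewrite /weight (_ : [pick e | _] = [pick e | splits_as G e (s @: A)])//.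
by apply: eq_pick => e; exact: relabel_splits.
Qed.

End Relabel.

(** * Trees with two given splits *)

Section TwoSplits.
Context {n : nat} (i0 : 'I_n) (n3 : 2 < n).
Implicit Types (A B : {set 'I_n}).

Definition unrooted A : {set 'I_n} := if i0 \in A then ~: A else A.

Lemma unrooted_root A : i0 \notin unrooted A.
Proof. by rewrite /unrooted; case: ifPn => // i0A; rewrite inE i0A. Qed.

Lemma unrooted_same A : same_split (unrooted A) A.
Proof. by rewrite /unrooted; case: ifP => _; [exact: same_splitC|exact: same_split_refl]. Qed.

Lemma unrooted_proper A : proper_split (unrooted A) = proper_split A.
Proof. by rewrite /unrooted; case: ifP; rewrite ?proper_splitC. Qed.

Lemma splits_as_same (V E : finType) (G : lgraph n V E) e A B :
  same_split A B -> splits_as G e A = splits_as G e B.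
Proof.
by move=> /same_splitP AB; apply: eq_forallb => i; apply: eq_forallb => j; rewrite AB.
Qed.

Lemma two_splits_tree A B : proper_split A -> proper_split B -> compat A B ->
  exists (G : stree n) (e e' : 'I_(ne G)), splits_as G e A /\ splits_as G e' B.
Proof.
move=> pA pB cAB; pose F := [set unrooted A; unrooted B].
have cAB' : compat (unrooted A) (unrooted B).
  rewrite (compat_same _ (unrooted_same A)) compat_sym.
  by rewrite (compat_same _ (unrooted_same B)) compat_sym.
have nested : [|| unrooted A \subset unrooted B, unrooted B \subset unrooted A
    | [disjoint unrooted A & unrooted B]].
  move: cAB'; rewrite compatE; case/or4P => AB.
  - by rewrite AB orbT.
  - by rewrite finset.disjoints_subset finset.subsetC AB !orbT.
  - have := fintype.subsetP AB i0; rewrite inE unrooted_root => /(_ isT) i0A.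
    by have := unrooted_root A; rewrite i0A.
  - by rewrite -finset.setCS AB.
have lamF : laminar i0 F.
  split=> [C|C D]; rewrite !inE => /pred2P CE.
    by case: CE => ->; rewrite unrooted_root unrooted_proper.
  move=> /pred2P[] ->; case: CE => ->; rewrite ?subxx ?orbT //.
  by move: nested; rewrite disjoint_sym orbCA.
have AF : unrooted A \in F by rewrite set21.
have BF : unrooted B \in F by rewrite set22.
have [k kA] := elab_onto AF; have [l lB] := elab_onto BF.
exists (hierarchy_stree lamF n3), k, l.
rewrite -(splits_as_same _ _ (unrooted_same A)) -(splits_as_same _ _ (unrooted_same B)).
by rewrite -kA -lB; split; exact: (hierarchy_splits lamF).
Qed.

End TwoSplits.

(** * Integral linear bijections *)

Local Open Scope ring_scope.

Section RealWeight.
Context {R : realType} {n : nat} (G : stree n).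

Definition nonneg_row k (x : 'rV[R]_k) : Prop := forall e, 0 <= x 0 e.

Definition rweight (x : 'rV[R]_(ne G)) : {set 'I_n} -> R := weight 0 G (x 0).

Lemma rweight_sum x A : rweight x A = \sum_e x 0 e * (splits_as G e A)%:R.
Proof.
have tG := stree_tree G; have sG := @stree_stable n G.
have [/existsP[e eA]|/existsPn noA] := boolP [exists e, splits_as G e A].
  rewrite /rweight (weight_edge _ _ tG sG eA) (bigD1 e) //= eA mulr1 big1 ?addr0 // => e' ne.
  case e'A: (splits_as G e' A); last by rewrite mulr0.
  by case/eqP: ne; exact: (splits_as_inj tG sG e'A eA).
by rewrite /rweight weight_none // big1 // => e _; rewrite (negbTE (noA e)) mulr0.
Qed.

Lemma rweight_edge x A e : splits_as G e A -> rweight x A = x 0 e.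
Proof. exact: weight_edge (stree_tree G) (@stree_stable n G). Qed.

Lemma rweightZ a x A : rweight (a *: x) A = a * rweight x A.
Proof.
by rewrite !rweight_sum mulr_sumr; apply: eq_bigr => e _; rewrite mxE mulrA.
Qed.

Lemma rweight_le (x y : 'rV[R]_(ne G)) A : (forall e, x 0 e <= y 0 e) -> rweight x A <= rweight y A.
Proof.
by move=> xy; rewrite !rweight_sum; apply: ler_sum => e _; rewrite ler_wpM2r ?ler0n.
Qed.

Lemma rweight_ge0 x A : nonneg_row x -> 0 <= rweight x A.
Proof.
by move=> x0; rewrite rweight_sum; apply: sumr_ge0 => e _; rewrite mulr_ge0 ?ler0n.
Qed.

Definition ray (e : 'I_(ne G)) : 'rV[R]_(ne G) := delta_mx 0 e.

Lemma ray_ge0 e : nonneg_row (ray e).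
Proof. by move=> k; rewrite mxE ler0n. Qed.

Lemma rweight_ray e A : rweight (ray e) A = (splits_as G e A)%:R.
Proof.
rewrite rweight_sum (bigD1 e) //= mxE !eqxx mul1r big1 ?addr0 // => k ne.
by rewrite mxE (negbTE ne) andbF mul0r.
Qed.

Lemma edge_split (i0 : 'I_n) (e : 'I_(ne G)) : exists A, splits_as G e A.
Proof. by exists (far_legs G i0 e); exact: splits_as_far (stree_tree G) e. Qed.

End RealWeight.

Arguments ray {R n} G e.
Arguments rweight {R n} G x A.

Section LinearBijections.
Context {R : realType} {n : nat} (i0 : 'I_n) (n3 : (2 < n)%N).
(* The points c x stand for those of the complex, or for the finite points of the
   extended complex; both are determined by their weights. *)
Context (Y : Type) (c : forall G : stree n, 'rV[R]_(ne G) -> Y).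
Hypothesis cP : forall (G H : stree n) x y, nonneg_row x -> nonneg_row y ->
  c x = c y <-> rweight G x = rweight H y.
Implicit Types (G H K : stree n) (A B : {set 'I_n}).

(** It is enough to consider matrices that map the orthant to the orthant, these
    being the ones through which a map of complexes factors. *)
Definition linear_on (f : Y -> Y) G H (M : 'M[int]_(ne G, ne H)) : Prop :=
  forall x : 'rV[R]_(ne G), nonneg_row x ->
    nonneg_row (x *m map_mx intr M) /\ f (c x) = c (x *m map_mx intr M).

Definition conewise_linear (f : Y -> Y) : Prop :=
  forall G, exists H (M : 'M[int]_(ne G, ne H)), linear_on f M.

Lemma nonneg_rowZ k a (x : 'rV[R]_k) : 0 <= a -> nonneg_row x -> nonneg_row (a *: x).
Proof. by move=> a0 x0 e; rewrite mxE mulr_ge0. Qed.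

Lemma ray_eq G H e e' A : splits_as G e A -> splits_as H e' A ->
  c (ray G e) = c (ray H e').
Proof.
move=> eA e'A; apply/cP; try exact: ray_ge0.
apply/funext => B; rewrite !rweight_ray.
by rewrite (same_split_splits _ eA) (same_split_splits _ e'A).
Qed.

Lemma mulmx_ray G (e : 'I_(ne G)) m (M : 'M[int]_(ne G, m)) j :
  (ray G e *m map_mx intr M) 0 j = (M e j)%:~R :> R.
Proof. by rewrite -rowE !mxE. Qed.

(** Let y be the image of the unit vector of e, and j an edge of H with y_j > 0.
    Since f' is linear on the cone of H, the image of the ray of j under f' is a
    summand of a point of the ray of e, hence it is itself in that ray, at height
    t say. Applying f, the unit vector of j is t y. So y is y_j times this unit
    vector, and y_j = 1 because t and y_j are integers with t y_j = 1. *)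
Lemma linear_ray f f' G H (M : 'M[int]_(ne G, ne H)) e :
  cancel f f' -> cancel f' f -> conewise_linear f' -> linear_on f M ->
  exists j, ray G e *m map_mx intr M = ray H j :> 'rV[R]_(ne H).
Proof.
move=> fK f'K f'lin fM; have [y0] := fM _ (ray_ge0 (R := R) e).
set y := ray G e *m _ in y0 * => fe.
have [A eA] := edge_split i0 e.
have [K [N f'N]] := f'lin H.
have [yN0] := f'N _ y0; rewrite -fe fK => /esym yN.
have {}yN : rweight K (y *m map_mx intr N) = rweight G (ray G e).
  by apply/cP => //; exact: ray_ge0.
have [j yj] : exists j, 0 < y 0 j.
  apply/existsP; apply: contraT => /existsPn yn0.
  have {}yn0 : y = 0.
    by apply/rowP => j; apply/eqP; rewrite [X in _ == X]mxE eq_le y0 andbT leNgt yn0.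
  have := congr1 (@^~ A) yN; rewrite /= rweight_ray eA yn0 mul0mx rweight_sum.
  by rewrite big1 => [/eqP|k _]; rewrite ?mxE ?mul0r // eq_sym oner_eq0.
have [Nj0 f'j] := f'N _ (ray_ge0 (R := R) j).
set Nj := ray H j *m _ in Nj0 f'j.
have Nj_le B : y 0 j * rweight K Nj B <= (splits_as G e B)%:R.
  rewrite -rweight_ray -yN -rweightZ; apply: rweight_le => k.
  have d0 : nonneg_row (y - y 0 j *: ray H j).
    move=> l; rewrite [X in 0 <= X]mxE [X in _ + X]mxE [X in - X]mxE [X in _ * X]mxE eqxx /=.
    by case: (l =P j) => [->|_]; rewrite ?mulr1 ?subrr // mulr0 subr0.
  have [+ _] := f'N _ d0 => /(_ k); rewrite mulmxBl -scalemxAl -/Nj.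
  by rewrite [X in 0 <= X]mxE [X in _ + X]mxE subr_ge0.
pose t := rweight K Nj A.
have t0 : 0 <= t by exact: rweight_ge0.
have Nj_t : rweight K Nj = rweight G (t *: ray G e).
  apply/funext => B; rewrite rweightZ rweight_ray.
  have [eB|eB] := boolP (splits_as G e B).
    rewrite mulr1 /t /rweight /weight.
    rewrite (eq_pick (Q := fun k => splits_as K k A)) // => k.
    by apply: splits_as_same; rewrite -(same_split_splits _ eB).
  rewrite mulr0; apply/eqP; rewrite eq_le rweight_ge0 // andbT.
  by have := Nj_le B; rewrite (negbTE eB) pmulr_rle0.
have Hj : rweight H (ray H j) = rweight H (t *: y).
  apply/cP; [exact: ray_ge0|exact: nonneg_rowZ|].
  rewrite -[LHS]f'K f'j /y scalemxAl.
  have te0 : nonneg_row (t *: ray G e) by apply: nonneg_rowZ => //; exact: ray_ge0.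
  by have [_ <-] := fM _ te0; congr f; apply/cP.
have tyj k : t * y 0 k = (k == j)%:R.
  have [B kB] := edge_split i0 k.
  have := congr1 (@^~ B) Hj; rewrite /= rweightZ !(rweight_edge _ kB) => <-.
  by rewrite mxE eqxx.
have t_neq0 : t != 0.
  by have := tyj j; rewrite eqxx; apply: contra_eq_neq => ->; rewrite mul0r eq_sym oner_eq0.
have yM k : y 0 k = (M e k)%:~R by exact: mulmx_ray.
have [k0 tk] : exists k, t = (N j k)%:~R.
  have [k kA tk] : exists2 k, splits_as K k A & t = Nj 0 k.
    by apply: weight_neq; apply/eqP.
  by exists k; rewrite tk; exact: mulmx_ray.
have M1 : M e j = 1.
  have := tyj j; rewrite eqxx yM tk -intrM => /eqP.
  rewrite -[1%:R]/(1%:~R) eqr_int => /eqP NM.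
  have : 0 < M e j by rewrite -(ltr_int R) -yM.
  move/(congr1 absz): NM => /eqP; rewrite abszM muln_eq1 => /andP[_ /eqP Mej] M0.
  by rewrite -(gtz0_abs M0) Mej.
exists j; apply/rowP => k; rewrite -/y [RHS]mxE eqxx /=.
have [->|ne] := eqVneq k j; first by rewrite yM M1.
by have /eqP := tyj k; rewrite (negbTE ne) mulf_eq0 (negbTE t_neq0) => /eqP.
Qed.

Definition ray_image (f : Y -> Y) A B : Prop :=
  exists G (e : 'I_(ne G)) H (j : 'I_(ne H)),
    [/\ splits_as G e A, splits_as H j B & f (c (ray G e)) = c (ray H j)].

Lemma ray_image_proper f A B : ray_image f A B -> proper_split A /\ proper_split B.
Proof.
move=> [G [e [H [j [eA jB _]]]]].
by split; [apply: splits_as_proper eA|apply: splits_as_proper jB];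
  (exact: stree_tree || exact: stree_stable).
Qed.

Lemma ray_image_same f A A' B B' : same_split A A' -> same_split B B' ->
  ray_image f A B -> ray_image f A' B'.
Proof.
move=> AA' BB' [G [e [H [j [eA jB fe]]]]]; exists G, e, H, j; split=> //.
  by rewrite -(splits_as_same _ _ AA').
by rewrite -(splits_as_same _ _ BB').
Qed.

Lemma ray_image_fun f A B B' : ray_image f A B -> ray_image f A B' -> same_split B B'.
Proof.
move=> [G [e [H [j [eA jB fe]]]]] [G' [e' [H' [j' [eA' jB' fe']]]]].
have : c (ray H j) = c (ray H' j') by rewrite -fe -fe' (ray_eq eA eA').
move/cP => /(_ (ray_ge0 _) (ray_ge0 _))/(congr1 (@^~ B')) /=.
rewrite !rweight_ray jB' (same_split_splits _ jB).
by case: same_split => // /eqP; rewrite eq_sym oner_eq0.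
Qed.

Lemma ray_image_inv f f' A B : cancel f f' -> ray_image f A B -> ray_image f' B A.
Proof.
move=> fK [G [e [H [j [eA jB fe]]]]]; exists H, j, G, e; split=> //.
by rewrite -fe fK.
Qed.

(** The sum of two compatible rays is a point of the cone of a tree with these two
    splits, and the images of both rays are edges of one and the same tree. *)
Lemma ray_image_compat f f' A A' B B' : cancel f f' -> cancel f' f ->
  conewise_linear f -> conewise_linear f' -> ray_image f A B -> ray_image f A' B' ->
  compat A A' -> compat B B'.
Proof.
move=> fK f'K f_lin f'_lin AB AB' cAA; have [pA _] := ray_image_proper AB.
have [pA' _] := ray_image_proper AB'.
have [G [e [e' [eA eA']]]] := two_splits_tree i0 n3 pA pA' cAA.
have [H [M fM]] := f_lin G.
have [j Mj] := linear_ray e fK f'K f'_lin fM.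
have [j' Mj'] := linear_ray e' fK f'K f'_lin fM.
have [C jC] := edge_split i0 j; have [C' jC'] := edge_split i0 j'.
have AC : ray_image f A C.
  by exists G, e, H, j; split=> //; have [_ ->] := fM _ (ray_ge0 e); rewrite Mj.
have AC' : ray_image f A' C'.
  by exists G, e', H, j'; split=> //; have [_ ->] := fM _ (ray_ge0 e'); rewrite Mj'.
rewrite (compat_same _ (ray_image_fun AB AC)) compat_sym.
rewrite (compat_same _ (ray_image_fun AB' AC')) compat_sym.
exact: (splits_as_compat (stree_tree H) (@stree_stable n H) jC jC').
Qed.

Section Bijection.
Context (f f' : Y -> Y).
Hypotheses (fK : cancel f f') (f'K : cancel f' f).
Hypotheses (f_lin : conewise_linear f) (f'_lin : conewise_linear f').

Lemma ray_image_total A : proper_split A -> exists B, ray_image f A B.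
Proof.
move=> pA; have cAA : compat A A by apply/compatP; exists true, false => i ->.
have [G [e [_ [eA _]]]] := two_splits_tree i0 n3 pA pA cAA.
have [H [M fM]] := f_lin G; have [j Mj] := linear_ray e fK f'K f'_lin fM.
have [B jB] := edge_split i0 j; exists B, G, e, H, j; split=> //.
by have [_ ->] := fM _ (ray_ge0 e); rewrite Mj.
Qed.

(** On the cone of a tree f is linear, so it is determined by the images of the
    rays of that cone. *)
Lemma conewise_linear_relabel (s : 'S_n) :
  (forall A B, ray_image f A B -> same_split B (s @: A)) ->
  forall G (x : 'rV[R]_(ne G)), nonneg_row x ->
    f (c x) = @c (relabel s^-1 G) x.
Proof.
move=> sf G x x0; have [H [M fM]] := f_lin G; have [xM0 ->] := fM _ x0.
have /choice[j Mj] e := linear_ray e fK f'K f'_lin fM.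
apply/cP => //; apply/funext => B.
rewrite [RHS]relabel_weight -[RHS]/(rweight G x _) !rweight_sum.
have -> : \sum_k (x *m map_mx intr M) 0 k * (splits_as H k B)%:R =
    \sum_e x 0 e * rweight H (ray G e *m map_mx intr M) B.
  under eq_bigr => k _ do rewrite mxE mulr_suml.
  rewrite exchange_big; apply: eq_bigr => e _; rewrite rweight_sum mulr_sumr.
  by apply: eq_bigr => k _; rewrite mulmx_ray mulrA [X in _ * X * _ = _]mxE.
apply: eq_bigr => e _; rewrite Mj rweight_ray; congr (_ * _%:R).
have [A eA] := edge_split i0 e; have [C jC] := edge_split i0 (j e).
have AC : ray_image f A C.
  by exists G, e, H, (j e); split=> //; have [_ ->] := fM _ (ray_ge0 e); rewrite Mj.
have jA : splits_as H (j e) (s @: A) by rewrite -(splits_as_same _ _ (sf _ _ AC)).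
rewrite (same_split_splits _ jA).
by rewrite (same_split_splits _ eA) same_split_perm.
Qed.

(** The map of splits lifts to a map of sets of legs if the image of A is taken to
    be the side that contains i0 exactly when A does. Setting it to the identity
    on the other sets makes it a bijection, for which counting is possible. *)
Lemma ray_bijection : exists F : {set 'I_n} -> {set 'I_n},
  [/\ injective F, forall A B, compat (F A) (F B) = compat A B,
      forall A, proper_split (F A) = proper_split A,
      forall A, (i0 \in F A) = (i0 \in A) /\ F (~: A) = ~: F A
    & forall A B, ray_image f A B -> same_split B (F A)].
Proof.
have /choice[F FP] A : exists B, (i0 \in B) = (i0 \in A) /\
    if proper_split A then ray_image f A B else B = A.
  have [pA|_] := boolP (proper_split A); last by exists A.
  have [B AB] : exists B, ray_image f A B by exact: ray_image_total.
  exists (if (i0 \in B) == (i0 \in A) then B else ~: B); case: eqP => [->//|ne].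
  split; first by rewrite inE; case: (i0 \in B) ne; case: (i0 \in A).
  apply: ray_image_same AB; first exact: same_split_refl.
  by rewrite /same_split finset.setCK eqxx orbT.
have Froot A : (i0 \in F A) = (i0 \in A) by case: (FP A).
have Fray A : proper_split A -> ray_image f A (F A) by move=> pA; have [_] := FP A; rewrite pA.
have Fid A : ~~ proper_split A -> F A = A by move=> /negbTE pA; have [_] := FP A; rewrite pA.
have Fp A : proper_split (F A) = proper_split A.
  have [pA|pA] := boolP (proper_split A); first by have [] := ray_image_proper (Fray A pA).
  by rewrite Fid // (negbTE pA).
have root_eq A B : same_split A B -> (i0 \in A) = (i0 \in B) -> A = B.
  by case/orP=> /eqP // ->; rewrite inE; case: (i0 \in B).
exists F; split=> //.
- move=> A B AB; have [pA|pA] := boolP (proper_split A); last first.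
    have pB : ~~ proper_split B by rewrite -Fp -AB Fp.
    by rewrite -(Fid _ pA) -(Fid _ pB).
  have pB : proper_split B by rewrite -Fp -AB Fp.
  have FA := ray_image_inv fK (Fray A pA); have FB := ray_image_inv fK (Fray B pB).
  rewrite -AB in FB; apply: root_eq; first exact: ray_image_fun FA FB.
  by rewrite -(Froot A) -(Froot B) AB.
- move=> A B; have [pA|pA] := boolP (proper_split A); last first.
    by rewrite !compat_improper ?Fp.
  have [pB|pB] := boolP (proper_split B); last first.
    by rewrite compat_sym [RHS]compat_sym !compat_improper ?Fp.
  have FA := Fray A pA; have FB := Fray B pB.
  apply/idP/idP; last exact: ray_image_compat fK f'K f_lin f'_lin FA FB.
  exact: (ray_image_compat f'K fK f'_lin f_lin (ray_image_inv fK FA) (ray_image_inv fK FB)).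
- move=> A; split=> //; have [pA|pA] := boolP (proper_split A); last first.
    by rewrite !Fid ?proper_splitC.
  have pA' : proper_split (~: A) by rewrite proper_splitC.
  apply: root_eq; last by rewrite Froot !inE Froot.
  apply: ray_image_fun (Fray _ pA') _; apply: ray_image_same (Fray A pA).
    by rewrite /same_split finset.setCK eqxx orbT.
  by rewrite /same_split finset.setCK eqxx orbT.
- move=> A B AB; have [pA _] := ray_image_proper AB.
  exact: ray_image_fun AB (Fray A pA).
Qed.

End Bijection.

(** The permutation of the legs is found from the action on splits; its inverse
    appears since relabelling acts on weights by precomposition. *)
Lemma conewise_linear_perm f f' : (4 < n)%N -> cancel f f' -> cancel f' f ->
  conewise_linear f -> conewise_linear f' ->
  exists s : 'S_n, forall G (x : 'rV[R]_(ne G)), nonneg_row x ->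
    f (c x) = @c (relabel s G) x.
Proof.
move=> n5 fK f'K f_lin f'_lin.
have [F [F_inj F_compat F_proper _ FP]] := ray_bijection fK f'K f_lin f'_lin.
have [s sP] := split_bijection_perm n5 F_inj F_compat F_proper.
exists s^-1%g; apply: (conewise_linear_relabel fK f'K f_lin f'_lin) => A B AB.
have [pA _] := ray_image_proper AB; apply: same_split_trans (sP A pA).
exact: FP.
Qed.

End LinearBijections.

Lemma conewise_linear_perm4 (R : realType) (Y : Type)
    (c : forall G : stree 4, 'rV[R]_(ne G) -> Y) (f f' : Y -> Y) :
  (forall (G H : stree 4) x y, nonneg_row x -> nonneg_row y ->
     c G x = c H y <-> rweight G x = rweight H y) ->
  cancel f f' -> cancel f' f -> conewise_linear c f -> conewise_linear c f' ->
  exists t : 'S_3, forall G (x : 'rV[R]_(ne G)), nonneg_row x ->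
    f (c G x) = c (relabel (lift_perm ord_max ord_max t) G) x.
Proof.
move=> cP fK f'K f_lin f'_lin.
have [F [F_inj _ F_proper Froot FP]] :=
  ray_bijection (ord_max : 'I_4) isT cP fK f'K f_lin f'_lin.
have [t tP] := split_bijection_perm4 F_inj F_proper (fun A => (Froot A).1) (fun A => (Froot A).2).
exists t^-1%g; rewrite -lift_permV; set s : 'S_4 := lift_perm _ _ t.
have := conewise_linear_relabel (ord_max : 'I_4) cP fK f'K f_lin f'_lin (s := s).
apply=> A B AB; have [pA _] := ray_image_proper AB.
by apply: same_split_trans (tP A pA); exact: FP.
Qed.

Section RelabelComplex.
Context (T : topologicalType) (zero : T) (P : set T) (n : nat) (i0 : 'I_n).
Hypothesis n3 : (2 < n)%N.

Local Notation complex := (complex zero P n).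

(** The coordinates are kept: the trees before and after have the same edges. *)
Definition relabel_point (s : 'S_n) (p : cone_sum P n) : cone_sum P n :=
  existT (fun G : stree n => orthant P (ne G)) (relabel s (projT1 p)) (projT2 p).

Lemma relabel_point_weight s p A :
  sum_weight zero (relabel_point s p) A = sum_weight zero p (s @: A).
Proof. exact: relabel_weight. Qed.

Definition relabel_complex (s : 'S_n) (q : complex) : complex :=
  \pi_(complex)%qT (relabel_point s (repr q)).

Lemma relabel_complex_weight s (q : complex) A :
  cweight (relabel_complex s q) A = cweight q (s @: A).
Proof. by rewrite (cweight_pi zero i0 n3) relabel_point_weight. Qed.

Lemma relabel_complex_pi s p :
  relabel_complex s (\pi_(complex)%qT p) = \pi_(complex)%qT (relabel_point s p).
Proof.
apply: (cweight_inj i0 n3); apply/funext => A.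
by rewrite relabel_complex_weight !(cweight_pi zero i0 n3) relabel_point_weight.
Qed.

Lemma relabel_complexM s t (q : complex) :
  relabel_complex (s * t)%g q = relabel_complex s (relabel_complex t q).
Proof.
apply: (cweight_inj i0 n3); apply/funext => A; rewrite !relabel_complex_weight.
by rewrite -imset_comp; congr cweight; apply: eq_imset => i; rewrite permM.
Qed.

Lemma relabel_complex1 (q : complex) : relabel_complex 1%g q = q.
Proof.
apply: (cweight_inj i0 n3); apply/funext => A; rewrite relabel_complex_weight.
congr cweight; rewrite -[RHS]imset_id; apply: eq_imset => i; exact: perm1.
Qed.

Lemma relabel_complexK s : cancel (@relabel_complex s) (relabel_complex s^-1%g).
Proof. by move=> q; rewrite -relabel_complexM mulVg relabel_complex1. Qed.

Lemma relabel_complex_continuous s : continuous (@relabel_complex s).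
Proof.
apply/quotient_continuous.
have -> : relabel_complex s \o \pi_(complex)%qT =
    \pi_(complex)%qT \o relabel_point s.
  by apply/funext => p; exact: relabel_complex_pi.
pose h (G : stree n) (x : orthant P (ne G)) : complex :=
  \pi_(complex)%qT (existT (fun G : stree n => orthant P (ne G)) (relabel s G) x).
apply: (sigT_continuous h) => G x.
apply: (@continuous_comp _ _ _ (existT (fun G : stree n => orthant P (ne G)) (relabel s G))
  (\pi_(complex)%qT)); last exact: pi_continuous.
exact: (@existT_continuous (stree n) (fun G : stree n => orthant P (ne G)) (relabel s G)).
Qed.

Lemma ray_point (one : T) A : zero != one -> P zero -> P one -> proper_split A ->
  exists q : complex, forall B, cweight q B = if same_split A B then one else zero.
Proof.
move=> zo Pz Po pA; have cAA : compat A A by apply/compatP; exists true, false => i ->.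
have [G [e [_ [eA _]]]] := two_splits_tree i0 n3 pA pA cAA.
have xP : orthant P (ne G) (\row_k (if k == e then one else zero))%R.
  by move=> k; rewrite mxE; case: ifP.
exists (cone_point G (SigSub (mem_set xP))) => B.
rewrite (cweight_point zero i0 n3) -(same_split_splits _ eA).
case: ifPn => [eB|eB].
  by rewrite (weight_edge _ _ (stree_tree G) (@stree_stable n G) eB) mxE eqxx.
rewrite /weight; case: pickP => // k kB; rewrite mxE; case: eqP => // ke.
by rewrite -ke kB in eB.
Qed.

(** Compare the images of the unit point on the ray of a split. *)
Lemma relabel_complex_split (one : T) s t A : zero != one -> P zero -> P one ->
  relabel_complex s = relabel_complex t -> proper_split A ->
  same_split (s @: A) (t @: A).
Proof.
move=> zo Pz Po st pA.
have psA : proper_split (t @: A).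
  by move: pA; rewrite /proper_split; have := cardsC A; have := cardsC (t @: A);
    rewrite card_imset; [lia|exact: perm_inj].
have [q qE] := ray_point zo Pz Po psA.
have := congr1 (fun f => cweight (f q) A) st.
rewrite /= !relabel_complex_weight !qE same_split_refl.
rewrite same_split_sym; case: same_split => // /eqP.
by rewrite (negbTE zo).
Qed.

End RelabelComplex.

(** * Automorphisms *)

Lemma group_isomorphic_of (G H : groupType) (h : H -> G) :
  {morph h : x y / (x * y)%g} -> injective h -> (forall y, exists x, h x = y) ->
  group_isomorphic G H.
Proof.
move=> hM h_inj h_surj; have [g hK gK] := inj_surj_bij h_inj h_surj.
have gM : {morph g : x y / (x * y)%g}.
  by move=> x y; apply: h_inj; rewrite hM !gK.
pose gg : {multiplicative G -> H} := HB.pack g (isMultiplicative.Build G H g gM).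
by exists gg, h.
Qed.

(** For five or more legs the complement of a pair is not a pair, and two
    pairs through a leg determine it. *)
Lemma perm_pairs n (s t : 'S_n) : (4 < n)%N ->
  (forall A, proper_split A -> same_split (s @: A) (t @: A)) -> s = t.
Proof.
move=> n5 st.
have pair i j : i != j -> [set s i; s j] = [set t i; t j].
  move=> ij; have := st _ (proper_pair n5 ij); rewrite !imsetU1 !imset_set1.
  case/orP=> /eqP // E; have := cardsC [set t i; t j]; rewrite -E !cards2.
  rewrite !(inj_eq perm_inj) ij card_ord /= => n4; exfalso.
  by move: n5; rewrite -[X in (4 < X)%N]n4.
apply/permP => i.
have [j] := fresh (s := [:: i]) (ltnW (ltnW (ltnW n5))); rewrite !inE => ji.
have [k] := fresh (s := [:: i; j]) (ltnW (ltnW n5)); rewrite !inE negb_or => /andP[ki kj].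
have := set21 (s i) (s j); rewrite pair 1?eq_sym // !inE => /pred2P[//|sitj].
have := set21 (s i) (s k); rewrite pair 1?eq_sym // !inE => /pred2P[//|].
by rewrite sitj => /perm_inj jk; rewrite jk eqxx in kj.
Qed.

(** Both permutations fix the last leg, which singles out a side of each split. *)
Lemma perm_pairs4 (s t : 'S_3) :
  (forall A : {set 'I_4}, proper_split A ->
     same_split (lift_perm ord_max ord_max s @: A) (lift_perm ord_max ord_max t @: A)) ->
  s = t.
Proof.
move=> st; apply/permP => k.
pose A : {set 'I_4} := [set ord_max; lift ord_max k].
have pA : proper_split A.
  have := cardsC A; rewrite /proper_split /A cards2 neq_lift card_ord.
  by rewrite -[(1 < #|~: _|)%N](ltn_add2l 2) => ->.
have := st A pA; rewrite /A !imsetU1 !imset_set1 !lift_perm_id !lift_perm_lift.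
case/orP=> /eqP/setP; last by move/(_ ord_max); rewrite !inE eqxx.
move/(_ (lift ord_max (s k))); rewrite !inE eqxx orbT eq_sym (negbTE (neq_lift _ _)).
by move=> /esym/eqP/lift_inj.
Qed.

Section Points.
Context {R : realType}.

(** Truncating at zero makes the points of a cone a total function of real rows,
    which is the identity on rows with nonnegative entries. *)
Definition pos_row k (x : 'rV[R]_k) : 'rV[R]_k := map_mx (Num.max 0) x.

Lemma pos_row_ge0 k (x : 'rV[R]_k) : nonneg_row (pos_row x).
Proof. by move=> e; rewrite mxE le_max lexx. Qed.

Lemma pos_rowE k (x : 'rV[R]_k) : nonneg_row x -> pos_row x = x.
Proof. by move=> x0; apply/rowP => e; rewrite mxE max_r. Qed.

Lemma cone_mem k (x : 'rV[R]_k) : orthant (@nonneg R) k (pos_row x).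
Proof. exact: pos_row_ge0. Qed.

Definition rpoint k (x : 'rV[R]_k) : cone R k := SigSub (mem_set (cone_mem x)).

Lemma econe_mem k (x : 'rV[R]_k) : orthant (@enonneg R) k (map_mx EFin (pos_row x)).
Proof. by move=> e; rewrite mxE /enonneg /= lee_fin; exact: pos_row_ge0. Qed.

Definition epoint k (x : 'rV[R]_k) : econe R k := SigSub (mem_set (econe_mem x)).

Lemma coords_inj k (T : topologicalType) (P : set T) : injective (@coords T P k).
Proof. by move=> x y; exact: val_inj. Qed.

Lemma rpoint_coords k (x : cone R k) : rpoint (coords x) = x.
Proof.
by apply: coords_inj; rewrite /coords /= pos_rowE //; have /set_mem := valP x.
Qed.

(** Replacing infinite coordinates by N gives finite points that converge to x. *)
Lemma econe_dense k (u v : econe R k -> \bar R) : continuous u -> continuous v ->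
  (forall x, nonneg_row x -> u (epoint x) = v (epoint x)) -> u =1 v.
Proof.
move=> cu cv uv x.
pose w (N : nat) : 'rV[R]_k :=
  \row_j (if coords x 0 j is r%:E then r else N%:R).
have x0 j : (0 <= coords x 0%R j)%E by have /set_mem := valP x; apply.
have w0 N : nonneg_row (w N).
  by move=> j; rewrite mxE; have := x0 j; case: (coords x 0 j).
have wx : (epoint (w N) @[N --> \oo] --> x)%classic.
  apply/coords_cvgP => j.
  have -> : (fun N => coords (epoint (w N)) 0 j) = (fun N => (w N 0 j)%:E).
    by apply/funext => N; rewrite /coords /= pos_rowE // mxE.
  under eq_fun do rewrite mxE.
  have := x0 j; case: (coords x 0 j) => [r _|_|//]; first exact: cvg_cst.
  by apply/cvgeryP; exact: cvgr_idn.
have ux := cvg_comp _ _ wx (cu x); have vx := cvg_comp _ _ wx (cv x).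
apply: (cvg_unique (@ereal_hausdorff R) ux).
suff -> : u \o (fun N => epoint (w N)) = v \o (fun N => epoint (w N)) by exact: vx.
by apply/funext => N /=; exact: uv.
Qed.

Lemma econe_coord_continuous a b (g : econe R a -> econe R b) j :
  continuous g -> continuous (fun x => coords (g x) 0 j).
Proof. by move=> cg x; have /coords_cvgP := cg x; apply. Qed.

End Points.

Section FiniteComplex.
Context {R : realType} {n : nat} (i0 : 'I_n).
Hypothesis n3 : (2 < n)%N.

Definition cpoint (G : stree n) (x : 'rV[R]_(ne G)) : Mtrop R n := cone_point G (rpoint x).

Lemma cpointP (G H : stree n) x y : nonneg_row x -> nonneg_row y ->
  cpoint x = cpoint y <-> rweight G x = rweight H y.
Proof.
move=> x0 y0.
have E (K : stree n) (z : 'rV[R]_(ne K)) : nonneg_row z -> cweight (cpoint z) = rweight K z.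
  by move=> z0; rewrite (cweight_point 0 i0 n3) /coords /= pos_rowE.
by rewrite -!E //; split=> [->//|/(cweight_inj i0 n3)].
Qed.

Lemma complex_morphism_linear (f : Mtrop R n -> Mtrop R n) :
  complex_morphism f -> conewise_linear cpoint f.
Proof.
move=> [_ fG] G; have [H [g [[M gM] fg]]] := fG G.
exists H, M => x x0.
have gx : coords (g (rpoint x)) = x *m map_mx intr M.
  by rewrite gM /coords /= pos_rowE.
split; first by rewrite -gx => j; have /set_mem := valP (g (rpoint x)); apply.
by rewrite /cpoint fg -gx rpoint_coords.
Qed.

Lemma relabel_complex_morphism (s : 'S_n) :
  complex_morphism (relabel_complex (zero := 0 : R) (P := @nonneg R) s).
Proof.
split; first exact: (relabel_complex_continuous i0 n3).
move=> G; exists (relabel s G), id; split; first exact: cone_morphism_id.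
by move=> x; rewrite (relabel_complex_pi 0 i0 n3).
Qed.

Definition aut_relabel (s : 'S_n) : AutMtrop R n :=
  Defs.Aut (M := complex_endo R n) (relabel_complex_morphism s) (relabel_complex_morphism s^-1%g)
   (relabel_complexK i0 n3 s)
   (fun q => eq_ind _ (fun t => relabel_complex t (relabel_complex s^-1%g q) = q)
     (relabel_complexK i0 n3 s^-1%g q) _ (invgK s)).

Lemma aut_relabelM : {morph aut_relabel : s t / (s * t)%g}.
Proof.
by move=> s t; apply: aut_eq; apply/funext => q; exact: (relabel_complexM i0 n3).
Qed.

Lemma aut_relabel_split s t A : aut_relabel s = aut_relabel t -> proper_split A ->
  same_split (s @: A) (t @: A).
Proof.
move=> st; apply: (relabel_complex_split i0 n3 (one := 1 : R)) (congr1 (@aut_fun _ _) st).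
- by rewrite eq_sym oner_neq0.
- exact: lexx.
- exact: ler01.
Qed.

Lemma aut_relabel_eq (f : AutMtrop R n) s :
  (forall (G : stree n) (x : 'rV[R]_(ne G)), nonneg_row x ->
     f (cpoint x) = @cpoint (relabel s G) x) -> aut_relabel s = f.
Proof.
move=> fs; apply: aut_eq; apply/funext => q; rewrite -[q]reprK; case: (repr q) => G x.
rewrite [LHS](relabel_complex_pi 0 i0 n3) -[x]rpoint_coords.
have x0 : nonneg_row (coords x) by have /set_mem := valP x.
exact/esym/fs.
Qed.

End FiniteComplex.

Section ExtendedComplex.
Context {R : realType} {n : nat} (i0 : 'I_n).
Hypothesis n3 : (2 < n)%N.

Definition epcpoint (G : stree n) (x : 'rV[R]_(ne G)) : eMtrop R n := cone_point G (epoint x).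

Lemma epoint_coords k (x : 'rV[R]_k) : nonneg_row x -> coords (epoint x) = map_mx EFin x.
Proof. by move=> x0; rewrite /coords /= pos_rowE. Qed.

Lemma epcpoint_weight (G : stree n) (x : 'rV[R]_(ne G)) A : nonneg_row x ->
  cweight (epcpoint x) A = (rweight G x A)%:E.
Proof.
move=> x0; rewrite (cweight_point 0%E i0 n3) epoint_coords // /rweight /weight.
by case: pickP => // e _; rewrite mxE.
Qed.

Lemma epcpointP (G H : stree n) x y : nonneg_row x -> nonneg_row y ->
  epcpoint x = epcpoint y <-> rweight G x = rweight H y.
Proof.
move=> x0 y0; split=> [xy|xy].
  by apply/funext => A; apply: EFin_inj; rewrite -!epcpoint_weight // xy.
by apply: (cweight_inj i0 n3); apply/funext => A; rewrite !epcpoint_weight // xy.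
Qed.

Lemma zero_row_ge0 k : nonneg_row (0 : 'rV[R]_k).
Proof. by move=> e; rewrite mxE. Qed.

(** If an infinite coordinate occurred in the image of a finite cone, it would
    occur at the image of the origin, hence in the images of all finite cones
    and by density in the image of every point; but the origin is in the image. *)
Lemma ecomplex_morphism_linear (f f' : eMtrop R n -> eMtrop R n) :
  cancel f' f -> ecomplex_morphism f -> conewise_linear epcpoint f.
Proof.
move=> f'K [_ fG] G; have [H [g [[cg [S [M gM]]] fg]]] := fG G.
have S0 : S = finset.set0.
  apply/setP => j; rewrite inE; apply/negP => jS.
  have [B jB] := edge_split i0 j.
  have [gj _] := gM (epoint 0) 0 (epoint_coords (@zero_row_ge0 _)).
  have fo : cweight (f (epcpoint (0 : 'rV_(ne G)))) B = +oo%E.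
    rewrite /epcpoint fg (cweight_point 0%E i0 n3).
    rewrite (weight_edge _ _ (stree_tree H) (@stree_stable n H) jB).
    by have := gj j; rewrite jS.
  pose o := epcpoint (0 : 'rV_(ne G)).
  have : cweight (f (f' o)) B = +oo%E.
    rewrite -[f' o]reprK; case: (repr (f' o)) => G' x'.
    have [H' [g' [[cg' [S' [M' gM']]] fg']]] := fG G'.
    have [gj' gM0] := gM' (epoint 0) 0 (epoint_coords (@zero_row_ge0 _)).
    have fo' : cweight (f (epcpoint (0 : 'rV_(ne G')))) B = +oo%E.
      rewrite -fo; congr (cweight (f _) B); apply/epcpointP; try exact: zero_row_ge0.
      by apply/funext => A; rewrite !rweight_sum !big1 // => e _; rewrite mxE mul0r.
    move: fo'; rewrite /epcpoint fg' (cweight_point 0%E i0 n3) => wB.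
    have [|j' j'B wj'] := @weight_neq _ 0%E _ _ _ H' (coords (g' (epoint 0)) 0) B.
      by rewrite wB.
    have j'S : j' \in S'.
      by apply: contraT => j'S; move: wj'; rewrite wB (gM0 j' j'S).
    have -> : \pi_(eMtrop R n)%qT (existT _ G' x') = cone_point G' x' by [].
    rewrite fg' (cweight_point 0%E i0 n3).
    rewrite (weight_edge _ _ (stree_tree H') (@stree_stable n H') j'B).
    apply: (econe_dense (v := cst +oo%E) (econe_coord_continuous (j := j') cg')).
      exact: cst_continuous.
    move=> y y0; have [yj' _] := gM' (epoint y) y (epoint_coords y0).
    by have := yj' j'; rewrite j'S.
  rewrite f'K epcpoint_weight; last exact: zero_row_ge0.
  by [].
exists H, M => x x0; have [_ gx] := gM (epoint x) x (epoint_coords x0).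
have {}gx : coords (g (epoint x)) = map_mx EFin (x *m map_mx intr M).
  by apply/rowP => j; rewrite gx ?S0 ?inE // [RHS]mxE.
have xM0 : nonneg_row (x *m map_mx intr M).
  move=> j; rewrite -lee_fin; have := congr1 (fun z : 'rV_(ne H) => z 0 j) gx.
  by rewrite /= [in RHS]mxE => <-; have /set_mem := valP (g (epoint x)); apply.
split=> //; rewrite /epcpoint fg; congr cone_point.
by apply: coords_inj; rewrite gx epoint_coords.
Qed.

Lemma relabel_ecomplex_morphism (s : 'S_n) :
  ecomplex_morphism (relabel_complex (zero := 0%E : \bar R) (P := @enonneg R) s).
Proof.
split; first exact: (relabel_complex_continuous i0 n3).
move=> G; exists (relabel s G), id; split; first exact: econe_morphism_id.
by move=> x; rewrite (relabel_complex_pi 0%E i0 n3).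
Qed.

Definition eaut_relabel (s : 'S_n) : AuteMtrop R n :=
  Defs.Aut (M := ecomplex_endo R n)
   (relabel_ecomplex_morphism s) (relabel_ecomplex_morphism s^-1%g)
   (relabel_complexK i0 n3 s)
   (fun q => eq_ind _ (fun t => relabel_complex t (relabel_complex s^-1%g q) = q)
     (relabel_complexK i0 n3 s^-1%g q) _ (invgK s)).

Lemma eaut_relabelM : {morph eaut_relabel : s t / (s * t)%g}.
Proof.
by move=> s t; apply: aut_eq; apply/funext => q; exact: (relabel_complexM i0 n3).
Qed.

Lemma eaut_relabel_split s t A : eaut_relabel s = eaut_relabel t -> proper_split A ->
  same_split (s @: A) (t @: A).
Proof.
move=> st; apply: (relabel_complex_split i0 n3 (one := 1%E : \bar R)) (congr1 (@aut_fun _ _) st).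
- by rewrite eq_sym onee_neq0.
- by rewrite /enonneg /=.
- by rewrite /enonneg /= lee01.
Qed.

Lemma cweight_cone_continuous (G : stree n) (f : eMtrop R n -> eMtrop R n) A :
  ecomplex_morphism f -> continuous (fun x : econe R (ne G) => cweight (f (cone_point G x)) A).
Proof.
move=> [_ fG]; have [H [g [[cg _] fg]]] := fG G.
have -> : (fun x => cweight (f (cone_point G x)) A) =
    (fun x => weight 0%E H (coords (g x) 0) A).
  by apply/funext => x; rewrite fg (cweight_point 0%E i0 n3).
rewrite /weight; case: pickP => [j _|_]; first exact: econe_coord_continuous.
exact: cst_continuous.
Qed.

(** Both maps are continuous, and the finite points are dense. *)
Lemma eaut_relabel_eq (f : AuteMtrop R n) s :
  (forall (G : stree n) (x : 'rV[R]_(ne G)), nonneg_row x ->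
     f (epcpoint x) = @epcpoint (relabel s G) x) -> eaut_relabel s = f.
Proof.
move=> fs; apply: aut_eq; apply/funext => q; rewrite -[q]reprK; case: (repr q) => G x.
apply: (cweight_inj i0 n3); apply/funext => A.
suff /(_ x) : (fun x : econe R (ne G) => cweight (eaut_relabel s (cone_point G x)) A)
    =1 (fun x => cweight (f (cone_point G x)) A) by [].
apply: econe_dense => [||y y0].
- exact: cweight_cone_continuous (aut_funP (eaut_relabel s)).
- exact: cweight_cone_continuous (aut_funP f).
congr (cweight _ A); rewrite -/(epcpoint y) fs //.
exact: (relabel_complex_pi 0%E i0 n3).
Qed.

End ExtendedComplex.

Theorem theorem3p13 (R : realType) :
  (forall n : nat, (5 <= n)%N ->
     group_isomorphic (AutMtrop R n) 'S_n /\
     group_isomorphic (AuteMtrop R n) 'S_n) /\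
  (group_isomorphic (AutMtrop R 4) 'S_3 /\
   group_isomorphic (AuteMtrop R 4) 'S_3).
Proof.
split=> [n n5|].
  have n3 : (2 < n)%N by exact: ltnW (ltnW n5).
  have i0 : 'I_n by exact: (Ordinal (ltnW (ltnW n3))).
  split.
    apply: (group_isomorphic_of (aut_relabelM (R := R) i0 n3)) => [s t st|f].
      by apply: perm_pairs => // A; exact: aut_relabel_split st.
    have [s fs] := conewise_linear_perm i0 n3 (cpointP i0 n3) n5 (aut_funK f) (aut_invK f)
      (complex_morphism_linear (aut_funP f)) (complex_morphism_linear (aut_invP f)).
    by exists s; exact: aut_relabel_eq.
  apply: (group_isomorphic_of (eaut_relabelM (R := R) i0 n3)) => [s t st|f].
    by apply: perm_pairs => // A; exact: eaut_relabel_split st.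
  have [s fs] := conewise_linear_perm i0 n3 (epcpointP i0 n3) n5 (aut_funK f) (aut_invK f)
    (ecomplex_morphism_linear i0 n3 (aut_invK f) (aut_funP f))
    (ecomplex_morphism_linear i0 n3 (aut_funK f) (aut_invP f)).
  by exists s; exact: eaut_relabel_eq.
pose i0 : 'I_4 := ord_max; pose n3 : (2 < 4)%N := isT.
pose l (t : 'S_3) : 'S_4 := lift_perm ord_max ord_max t.
have lM : {morph l : s t / (s * t)%g} by move=> s t; apply/esym; exact: lift_permM.
split.
  apply: (group_isomorphic_of (h := fun t => aut_relabel (R := R) i0 n3 (l t))) => [s t|s t st|f].
  - by rewrite lM aut_relabelM.
  - by apply: perm_pairs4 => A; exact: aut_relabel_split st.
  - have [s fs] := conewise_linear_perm4 (cpointP i0 n3) (aut_funK f) (aut_invK f)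
      (complex_morphism_linear (aut_funP f)) (complex_morphism_linear (aut_invP f)).
    by exists s; exact: aut_relabel_eq.
apply: (group_isomorphic_of (h := fun t => eaut_relabel (R := R) i0 n3 (l t))) => [s t|s t st|f].
- by rewrite lM eaut_relabelM.
- by apply: perm_pairs4 => A; exact: eaut_relabel_split st.
- have [s fs] := conewise_linear_perm4 (epcpointP i0 n3) (aut_funK f) (aut_invK f)
    (ecomplex_morphism_linear i0 n3 (aut_invK f) (aut_funP f))
    (ecomplex_morphism_linear i0 n3 (aut_funK f) (aut_invP f)).
  by exists s; exact: eaut_relabel_eq.
Qed.
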